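(* Over $\mathsf{WKL}_0$, $\mathsf{ACA}$ (arithmetical comprehension) is equivalent to the statement that every topological dynamical system $(C,f)$ on $2^\omega$ contains a minimal subsystem.
   Context: Work in second order arithmetic; $\omega$ denotes the natural numbers of the model. $2^{<\omega}$ is the set of finite binary strings, $\lambda$ the empty string, $|\sigma|$ the length of $\sigma$, $\preceq$ the initial segment relation (also between a string and an infinite sequence), and $X\upharpoonright_n$ the initial segment of $X$ of length $n$. A tree is a subset of $2^{<\omega}$ closed under initial segments; $[C]$ denotes the collection of infinite paths through a tree $C$. A function $f:2^{<\omega}\to 2^{<\omega}$ encodes a continuous transformation of $2^\omega$ if (1) $f$ is total; (2) $f$ is order preserving, i.e. $\sigma\preceq\tau$ implies $f(\sigma)\preceq f(\tau)$; (3) $(\forall l)(\exists m)(\forall\sigma\in\{0,1\}^m)\,|f(\sigma)|\ge l$. By convention such an $f$ is also assumed to satisfy $|f(\sigma)|<|\sigma|$ for all $\sigma\ne\lambda$. The transformation encoded is $F(X)=\lim_l f(X\upharpoonright_l)$. A pair $(C,f)$ is a (topological dynamical) system on $2^\omega$ if (i) $C$ is a tree; (ii) $f$ encodes a continuous transformation of $2^\omega$; (iii) $[C]\neq\emptyset$; (iv) for all $\sigma\in C$, $f(\sigma)\in C$. A subsystem of $(C,f)$ is a system $(D,f)$ (with the same $f$) such that $[D]\subseteq[C]$. A system $(D,f)$ is minimal if for every system $(E,f)$ with $[E]\subseteq[D]$ we have $[E]=[D]$. *)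

(* Defs.v *)
Set Implicit Arguments.
Unset Strict Implicit.
Unset Printing Implicit Defensive.

(* Structures for the two-sorted language of second order arithmetic (Henkin
   semantics): number quantifiers range over [num M], set quantifiers over
   [sets M].  Equality is a primitive on numbers only. *)
Record L2structure : Type := {
  num : Type;
  sets : Type;
  zero : num;
  one : num;
  add : num -> num -> num;
  mul : num -> num -> num;
  lt : num -> num -> Prop;
  mem : num -> sets -> Prop
}.

Declare Scope L2_scope.
Delimit Scope L2_scope with L2.
Bind Scope L2_scope with num.
Arguments zero {M} : rename.
Arguments one {M} : rename.
Arguments add {M} (_ _)%_L2 : rename.
Arguments mul {M} (_ _)%_L2 : rename.
Arguments lt {M} (_ _)%_L2 : rename.
Arguments mem {M} (_)%_L2 _ : rename.
Notation "0" := zero : L2_scope.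
Notation "1" := one : L2_scope.
Infix "+" := add : L2_scope.
Infix "*" := mul : L2_scope.
Infix "<" := lt : L2_scope.
Notation "x <= y" := (lt x y \/ x = y) : L2_scope.
Notation "x 'in_' X" := (mem x X) (at level 70) : L2_scope.
Open Scope L2_scope.

(* Arithmetical formulas: number quantifiers only, with free number and set
   variables (parameters).  Number variables are de Bruijn indices; set
   variables are never bound. *)
Inductive term : Type :=
| TVar (i : nat)
| TZero
| TOne
| TAdd (s t : term)
| TMul (s t : term).

Inductive formula : Type :=
| FEq (s t : term)
| FLt (s t : term)
| FMem (t : term) (X : nat)
| FNot (p : formula)
| FAnd (p q : formula)
| FOr (p q : formula)
| FImp (p q : formula)
| FAll (p : formula)
| FEx (p : formula).

Fixpoint shift (t : term) : term :=
  match t with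
  | TVar i => TVar (S i)
  | TZero => TZero
  | TOne => TOne
  | TAdd s t => TAdd (shift s) (shift t)
  | TMul s t => TMul (shift s) (shift t)
  end.

(* The [shift] ensures that the bound does not contain the bound variable. *)
Inductive bounded : formula -> Prop :=
| BEq s t : bounded (FEq s t)
| BLt s t : bounded (FLt s t)
| BMem t X : bounded (FMem t X)
| BNot p : bounded p -> bounded (FNot p)
| BAnd p q : bounded p -> bounded q -> bounded (FAnd p q)
| BOr p q : bounded p -> bounded q -> bounded (FOr p q)
| BImp p q : bounded p -> bounded q -> bounded (FImp p q)
| BAll t p : bounded p -> bounded (FAll (FImp (FLt (TVar 0%nat) (shift t)) p))
| BEx t p : bounded p -> bounded (FEx (FAnd (FLt (TVar 0%nat) (shift t)) p)).

Inductive Sigma01 : formula -> Prop :=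
| Sigma01_intro p : bounded p -> Sigma01 (FEx p).

Inductive Pi01 : formula -> Prop :=
| Pi01_intro p : bounded p -> Pi01 (FAll p).

Definition scons (A : Type) (x : A) (e : nat -> A) : nat -> A :=
  fun i => match i with O => x | S j => e j end.

Fixpoint eval (M : L2structure) (e : nat -> num M) (t : term) : num M :=
  match t with
  | TVar i => e i
  | TZero => 0
  | TOne => 1
  | TAdd s t => eval e s + eval e t
  | TMul s t => eval e s * eval e t
  end.

Fixpoint sat (M : L2structure) (V : nat -> sets M) (e : nat -> num M)
    (p : formula) : Prop :=
  match p with
  | FEq s t => eval e s = eval e t
  | FLt s t => eval e s < eval e t
  | FMem t X => eval e t in_ V X
  | FNot p => ~ sat V e p
  | FAnd p q => sat V e p /\ sat V e q
  | FOr p q => sat V e p \/ sat V e q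
  | FImp p q => sat V e p -> sat V e q
  | FAll p => forall x : num M, sat V (scons x e) p
  | FEx p => exists x : num M, sat V (scons x e) p
  end.

Record basic_axioms (M : L2structure) : Prop := {
  ax_succ_neq0 : forall n : num M, n + 1 <> 0;
  ax_succ_inj : forall m n : num M, m + 1 = n + 1 -> m = n;
  ax_add0 : forall m : num M, m + 0 = m;
  ax_addS : forall m n : num M, m + (n + 1) = (m + n) + 1;
  ax_mul0 : forall m : num M, m * 0 = 0;
  ax_mulS : forall m n : num M, m * (n + 1) = m * n + m;
  ax_lt0 : forall m : num M, ~ m < 0;
  ax_ltS : forall m n : num M, m < n + 1 <-> m < n \/ m = n
}.

(* In the three schemes the distinguished variable is variable 0, and [V], [e]
   supply the parameters. *)
Definition Sigma01_induction (M : L2structure) : Prop :=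
  forall (p : formula) (V : nat -> sets M) (e : nat -> num M),
    Sigma01 p ->
    sat V (scons 0 e) p ->
    (forall n, sat V (scons n e) p -> sat V (scons (n + 1) e) p) ->
    forall n, sat V (scons n e) p.

Definition Delta01_comprehension (M : L2structure) : Prop :=
  forall (p q : formula) (V : nat -> sets M) (e : nat -> num M),
    Sigma01 p -> Pi01 q ->
    (forall n, sat V (scons n e) p <-> sat V (scons n e) q) ->
    exists X : sets M, forall n, n in_ X <-> sat V (scons n e) p.

(* No restriction on [p]: [formula] has no set quantifiers. *)
Definition ACA (M : L2structure) : Prop :=
  forall (p : formula) (V : nat -> sets M) (e : nat -> num M),
    exists X : sets M, forall n, n in_ X <-> sat V (scons n e) p.

(* The set sort of a structure is nonempty by convention; without this the
   schemes above, quantified over valuations [V], would be vacuous. *)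
Record RCA0 (M : L2structure) : Prop := {
  RCA0_inhabited : inhabited (sets M);
  RCA0_basic : basic_axioms M;
  RCA0_induction : Sigma01_induction M;
  RCA0_comprehension : Delta01_comprehension M
}.

Definition pair (M : L2structure) (i j : num M) : num M :=
  (i + j) * (i + j) + i.

(* Goedel's beta function: [r] is the remainder of [a] modulo 1 + (i+1) b. *)
Definition beta (M : L2structure) (a b i r : num M) : Prop :=
  r < 1 + (i + 1) * b /\ exists q, a = q * (1 + (i + 1) * b) + r.

(* [pow2 l p] : p = 2^l in the sense of M. *)
Definition pow2 (M : L2structure) (l p : num M) : Prop :=
  exists a b,
    beta a b 0 1 /\
    (forall i, i < l -> exists r, beta a b i r /\ beta a b (i + 1) (r + r)) /\
    beta a b l p.

(* Binary strings are coded bijectively by numbers: the string s is coded by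
   the n for which n + 1 has binary expansion 1s.  Thus the empty string is 0,
   and every number is (the code of) a string. *)
Definition empty_str {M : L2structure} : num M := 0.
Definition snoc0 (M : L2structure) (s : num M) : num M := s + s + 1.
Definition snoc1 (M : L2structure) (s : num M) : num M := s + s + 1 + 1.

Definition len (M : L2structure) (s l : num M) : Prop :=
  exists p, pow2 l p /\ p <= s + 1 /\ s + 1 < p + p.

Definition prefix (M : L2structure) (s t : num M) : Prop :=
  exists k p r, pow2 k p /\ r < p /\ t + 1 = (s + 1) * p + r.

(* The i-th bit of s exists and is 1. *)
Definition bit1 (M : L2structure) (s i : num M) : Prop :=
  exists t, len t i /\ prefix (snoc1 t) s.

(* Elements of Cantor space are the sets of M, identified with their
   characteristic functions; [restr X n s] : s is the initial segment of X of
   length n. *)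
Definition restr (M : L2structure) (X : sets M) (n s : num M) : Prop :=
  len s n /\ forall i, i < n -> (i in_ X <-> bit1 s i).

Definition tree (M : L2structure) (C : sets M) : Prop :=
  forall s t, prefix s t -> t in_ C -> s in_ C.

Definition path (M : L2structure) (C X : sets M) : Prop :=
  forall n, exists s, restr X n s /\ s in_ C.

Definition infinite (M : L2structure) (C : sets M) : Prop :=
  forall n, exists s, n < s /\ s in_ C.

Definition WKL (M : L2structure) : Prop :=
  forall T : sets M, tree T -> infinite T -> exists X, path T X.

Definition WKL0 (M : L2structure) : Prop := RCA0 M /\ WKL M.

(* A function is a set of pairs; [maps f s t] : f(s) = t. *)
Definition maps (M : L2structure) (f : sets M) (s t : num M) : Prop :=
  pair s t in_ f.

Record encodes_continuous (M : L2structure) (f : sets M) : Prop := {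
  ec_pairs : forall n, n in_ f -> exists s t, n = pair s t;
  ec_functional : forall s t t', maps f s t -> maps f s t' -> t = t';
  ec_total : forall s, exists t, maps f s t;
  ec_monotone : forall s t s' t',
    prefix s t -> maps f s s' -> maps f t t' -> prefix s' t';
  ec_unbounded : forall l, exists m, forall s, len s m ->
    exists t k, maps f s t /\ len t k /\ l <= k;
  ec_shorter : forall s, s <> empty_str ->
    exists t k l, maps f s t /\ len t k /\ len s l /\ k < l
}.

Record is_system (M : L2structure) (C f : sets M) : Prop := {
  sys_tree : tree C;
  sys_map : encodes_continuous f;
  sys_nonempty : exists X, path C X;
  sys_closed : forall s t, s in_ C -> maps f s t -> t in_ C
}.

Definition paths_sub (M : L2structure) (D C : sets M) : Prop :=
  forall X, path D X -> path C X.

Definition subsystem (M : L2structure) (D C f : sets M) : Prop :=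
  is_system D f /\ paths_sub D C.

Definition minimal_system (M : L2structure) (D f : sets M) : Prop :=
  is_system D f /\
  forall E, is_system E f -> paths_sub E D -> forall X, path E X <-> path D X.

Definition minimal_subsystem_principle (M : L2structure) : Prop :=
  forall C f : sets M, is_system C f ->
    exists D, subsystem D C f /\ minimal_system D f.

(* Main.v *)
Require Import Defs.
From Stdlib Require Import Setoid Ring ClassicalEpsilon.

(** Two implications have to be shown inside a model M of WKL0, whose numbers
    may be nonstandard.

    From arithmetical comprehension to minimal subsystems: go through all
    strings j in turn and forbid j whenever the strings of C whose forward
    orbit under f avoids j, and everything forbidden so far, still form an
    infinite tree ([viable]).  Arithmetical comprehension makes these decisions
    uniformly, so they form a set [chosen] of the model.  The strings of C whose
    orbit avoids all chosen strings form a tree D, closed under f because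
    orbits of images are tails of orbits, and infinite because an orbit that
    starts with a string of length l only meets strings of length at most l
    ([avoids_chosen_ex]).  D is minimal: if a subsystem E misses an initial
    segment s of a path of D, then the initial segments of a path of E
    show that s could be forbidden, so s was forbidden and cannot lie in D.

    From minimal subsystems to arithmetical comprehension: it suffices that
    K = {n : exists t, R n t} is a set whenever R is; arithmetical comprehension
    follows by induction on formulas.  Read an infinite binary sequence as
    a table with the columns (n, 0), (n, 1), (n, 2) and so on, and let f shift
    every column by one place.  A tree C is imposed such that column n of a path
    is constantly 0, up to at most one 1, if n is not in K, while otherwise every
    long enough block of column n contains a 1 ([sparse], [dense]).  C is a set,
    although K need not be one, because a violation of either condition in a
    finite string is decided by the bounded search [entered]; it has a path by
    weak Koenig's lemma.  On a minimal subsystem D, column n vanishes identically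
    if n is not in K, since the paths of D where it vanishes form a
    subsystem; if n is in K, some path of D has a 1 at (n, 0).
    By compactness the first alternative is witnessed by a single length l such
    that no string of D of length l has a 1 at (n, 0) ([vanish]).  So the
    complement of K is Sigma01 too, and K exists by Delta01 comprehension.

    The groundwork develops arithmetic in M from Sigma01 induction: ordered
    semiring, pairing, Goedel's beta function, primitive recursion, binary strings.
    To keep formulas out of sight, almost everything is phrased with predicates
    that are extensions of sets of M ([is_set]) and with functions whose graph is
    a set of M ([is_fun]); the tactic [definable] proves such claims. *)

Section Model.
Variable M : L2structure.
Hypothesis HR : RCA0 M.

Notation num := (num M).
Notation sets := (sets M).

(** * Definability by bounded formulas *)

Definition term_def (F : (nat -> num) -> num) := exists t, forall e, F e = eval e t.
(** The valuation V of the set variables is fixed and the predicate depends on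
    the number variables only, so that bounded quantifiers become a shift of
    the indices. *)
Definition bounded_def (V : nat -> sets) (P : (nat -> num) -> Prop) :=
  exists p, bounded p /\ forall e, P e <-> sat V e p.

Lemma term_var i : term_def (fun e => e i).
Proof. exists (TVar i); reflexivity. Qed.
Lemma term_zero : term_def (fun _ => 0).
Proof. exists TZero; reflexivity. Qed.
Lemma term_one : term_def (fun _ => 1).
Proof. exists TOne; reflexivity. Qed.
Lemma term_add F G : term_def F -> term_def G -> term_def (fun e => F e + G e).
Proof. intros [s Hs] [t Ht]; exists (TAdd s t); intro e; simpl; rewrite Hs, Ht; reflexivity. Qed.
Lemma term_mul F G : term_def F -> term_def G -> term_def (fun e => F e * G e).
Proof. intros [s Hs] [t Ht]; exists (TMul s t); intro e; simpl; rewrite Hs, Ht; reflexivity. Qed.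

Lemma eval_shift e x t : eval (scons x e) (shift t) = eval (M := M) e t.
Proof. induction t; simpl; congruence. Qed.

Section BdClosure.
Variable V : nat -> sets.

Lemma bounded_eq F G : term_def F -> term_def G -> bounded_def V (fun e => F e = G e).
Proof.
  intros [s Hs] [t Ht]; exists (FEq s t); split; [constructor|].
  intro e; simpl; rewrite Hs, Ht; tauto.
Qed.
Lemma bounded_lt F G : term_def F -> term_def G -> bounded_def V (fun e => F e < G e).
Proof.
  intros [s Hs] [t Ht]; exists (FLt s t); split; [constructor|].
  intro e; simpl; rewrite Hs, Ht; tauto.
Qed.
Lemma bounded_mem F i : term_def F -> bounded_def V (fun e => F e in_ V i).
Proof.
  intros [s Hs]; exists (FMem s i); split; [constructor|].
  intro e; simpl; rewrite Hs; tauto.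
Qed.
Lemma bounded_not P : bounded_def V P -> bounded_def V (fun e => ~ P e).
Proof.
  intros [p [Bp Hp]]; exists (FNot p); split; [constructor; auto|].
  intro e; simpl; rewrite Hp; tauto.
Qed.
Lemma bounded_and P Q : bounded_def V P -> bounded_def V Q -> bounded_def V (fun e => P e /\ Q e).
Proof.
  intros [p [Bp Hp]] [q [Bq Hq]]; exists (FAnd p q); split; [constructor; auto|].
  intro e; simpl; rewrite Hp, Hq; tauto.
Qed.
Lemma bounded_or P Q : bounded_def V P -> bounded_def V Q -> bounded_def V (fun e => P e \/ Q e).
Proof.
  intros [p [Bp Hp]] [q [Bq Hq]]; exists (FOr p q); split; [constructor; auto|].
  intro e; simpl; rewrite Hp, Hq; tauto.
Qed.
Lemma bounded_imp P Q : bounded_def V P -> bounded_def V Q -> bounded_def V (fun e => P e -> Q e).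
Proof.
  intros [p [Bp Hp]] [q [Bq Hq]]; exists (FImp p q); split; [constructor; auto|].
  intro e; simpl; rewrite Hp, Hq; tauto.
Qed.
Lemma bounded_ex F P : term_def F -> bounded_def V (fun e => P (fun i => e (S i)) (e 0%nat)) ->
  bounded_def V (fun e => exists x, x < F e /\ P e x).
Proof.
  intros [t Ht] [p [Bp Hp]].
  exists (FEx (FAnd (FLt (TVar 0%nat) (shift t)) p)); split; [constructor; auto|].
  intro e; simpl; split; intros [x [H1 H2]]; exists x.
  - rewrite eval_shift, <- Ht; split; [exact H1|]. apply Hp; exact H2.
  - rewrite eval_shift, <- Ht in H1; split; [exact H1|]. apply Hp in H2; exact H2.
Qed.
Lemma bounded_all F P : term_def F -> bounded_def V (fun e => P (fun i => e (S i)) (e 0%nat)) ->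
  bounded_def V (fun e => forall x, x < F e -> P e x).
Proof.
  intros [t Ht] [p [Bp Hp]].
  exists (FAll (FImp (FLt (TVar 0%nat) (shift t)) p)); split; [constructor; auto|].
  intro e; simpl; split; intros H x; specialize (H x); rewrite eval_shift, <- Ht in *;
    intro Hx; specialize (H Hx).
  - apply Hp; exact H.
  - apply Hp in H; exact H.
Qed.

Lemma ind_ex P e : bounded_def V P ->
  (exists x, P (scons x (scons 0 e))) ->
  (forall n, (exists x, P (scons x (scons n e))) -> exists x, P (scons x (scons (n + 1) e))) ->
  forall n, exists x, P (scons x (scons n e)).
Proof.
  intros [p [Bp Hp]] H0 HS n.
  assert (K : forall n, sat V (scons n e) (FEx p) <-> exists x, P (scons x (scons n e))).
  { intro m; simpl; split; intros [x Hx]; exists x; apply Hp; exact Hx. }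
  apply K. apply (RCA0_induction HR).
  - constructor; exact Bp.
  - apply K; exact H0.
  - intros m Hm; apply K, HS, K, Hm.
Qed.

Lemma comprehension P Q e : bounded_def V P -> bounded_def V Q ->
  (forall n, (exists x, P (scons x (scons n e))) <-> (forall x, Q (scons x (scons n e)))) ->
  exists X, forall n, n in_ X <-> exists x, P (scons x (scons n e)).
Proof.
  intros [p [Bp Hp]] [q [Bq Hq]] H.
  assert (Kp : forall n, sat V (scons n e) (FEx p) <-> exists x, P (scons x (scons n e))).
  { intro m; simpl; split; intros [x Hx]; exists x; apply Hp; exact Hx. }
  assert (Kq : forall n, sat V (scons n e) (FAll q) <-> forall x, Q (scons x (scons n e))).
  { intro m; simpl; split; intros Hx x; apply Hq; apply Hx. }
  destruct (RCA0_comprehension HR (p := FEx p) (q := FAll q) (V := V) (e := e)) as [X HX].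
  - constructor; exact Bp.
  - constructor; exact Bq.
  - intro n; rewrite Kp, Kq; apply H.
  - exists X; intro n; rewrite HX; apply Kp.
Qed.
End BdClosure.

Ltac term_tac := repeat (cbv beta; first
  [ apply term_add | apply term_mul | apply term_zero | apply term_one | apply term_var ]).
Ltac bounded_tac := repeat (cbv beta; first
  [ solve [apply bounded_eq; term_tac] | solve [apply bounded_lt; term_tac] | solve [apply bounded_mem; term_tac]
  | apply bounded_ex; [solve [term_tac]|] | apply bounded_all; [solve [term_tac]|]
  | apply bounded_and | apply bounded_or | apply bounded_not | apply bounded_imp ]).

(** The induction scheme wants a leading existential quantifier; a dummy one is
    inserted, which raises the index of every variable by one. *)
Lemma ind_bounded V P e : bounded_def V (fun e => P (fun i => e (S i))) -> P (scons 0 e) ->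
  (forall n, P (scons n e) -> P (scons (n + 1) e)) -> forall n, P (scons n e).
Proof.
  intros HP H0 HS n.
  destruct (ind_ex V (fun e => P (fun i => e (S i))) e HP) with (n := n) as [x Hx].
  - exists 0; exact H0.
  - intros m [x Hx]; exists 0; apply HS; exact Hx.
  - exact Hx.
Qed.

Definition zeros : nat -> num := fun _ => 0.

Definition some_sets : nat -> sets := fun _ => epsilon (RCA0_inhabited HR) (fun _ => True).

Ltac ind3 P a b c n :=
  refine (ind_bounded some_sets P (scons a (scons b (scons c zeros))) _ _ _ n);
  [ bounded_tac | cbn | let m := fresh n in let IH := fresh "IH" in intro m; cbn; intro IH; cbn in IH ].

(** * The ordered semiring of numbers *)

Let ax := RCA0_basic HR.

Lemma add0 (x : num) : x + 0 = x. Proof. apply (ax_add0 ax). Qed.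
Lemma addS (x y : num) : x + (y + 1) = x + y + 1. Proof. apply (ax_addS ax). Qed.
Lemma addA (x y z : num) : x + (y + z) = x + y + z.
Proof.
  ind3 (fun e : nat -> num => e 1%nat + (e 2%nat + e 0%nat) = e 1%nat + e 2%nat + e 0%nat) x y x z.
  - now rewrite !add0.
  - now rewrite !addS, IH.
Qed.
Lemma add0l (x : num) : 0 + x = x.
Proof.
  ind3 (fun e : nat -> num => 0 + e 0%nat = e 0%nat) x x x x.
  - apply add0.
  - now rewrite addS, IH.
Qed.
Lemma addSl (x y : num) : x + 1 + y = x + y + 1.
Proof.
  ind3 (fun e : nat -> num => e 1%nat + 1 + e 0%nat = e 1%nat + e 0%nat + 1) x x x y.
  - now rewrite !add0.
  - now rewrite !addS, IH.
Qed.
Lemma addC (x y : num) : x + y = y + x.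
Proof.
  ind3 (fun e : nat -> num => e 1%nat + e 0%nat = e 0%nat + e 1%nat) x x x y.
  - now rewrite add0, add0l.
  - now rewrite addS, addSl, IH.
Qed.
Lemma mul0 (x : num) : x * 0 = 0. Proof. apply (ax_mul0 ax). Qed.
Lemma mulS (x y : num) : x * (y + 1) = x * y + x. Proof. apply (ax_mulS ax). Qed.
Lemma mul0l (x : num) : 0 * x = 0.
Proof.
  ind3 (fun e : nat -> num => 0 * e 0%nat = 0) x x x x.
  - apply mul0.
  - now rewrite mulS, IH, add0.
Qed.
Lemma mulSl (x y : num) : (x + 1) * y = x * y + y.
Proof.
  ind3 (fun e : nat -> num => (e 1%nat + 1) * e 0%nat = e 1%nat * e 0%nat + e 0%nat) x x x y.
  - now rewrite !mul0, add0.
  - rewrite !mulS, IH, <- !addA. f_equal. now rewrite !addA, (addC x).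
Qed.
Lemma mulC (x y : num) : x * y = y * x.
Proof.
  ind3 (fun e : nat -> num => e 1%nat * e 0%nat = e 0%nat * e 1%nat) x x x y.
  - now rewrite mul0, mul0l.
  - now rewrite mulS, mulSl, IH.
Qed.
Lemma mulDl (x y z : num) : (x + y) * z = x * z + y * z.
Proof.
  ind3 (fun e : nat -> num => (e 1%nat + e 2%nat) * e 0%nat = e 1%nat * e 0%nat + e 2%nat * e 0%nat) x y x z.
  - now rewrite !mul0, add0.
  - rewrite !mulS, IH, !addA. f_equal. now rewrite <- !addA, (addC x).
Qed.
Lemma mulA (x y z : num) : x * (y * z) = x * y * z.
Proof.
  ind3 (fun e : nat -> num => e 1%nat * (e 2%nat * e 0%nat) = e 1%nat * e 2%nat * e 0%nat) x y x z.
  - now rewrite !mul0.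
  - now rewrite !mulS, (mulC x), mulDl, <- IH, (mulC _ x), (mulC y x).
Qed.
Lemma mul1l (x : num) : 1 * x = x.
Proof. now rewrite mulC, <- (add0l 1), mulS, mul0, add0l. Qed.

Lemma num_semiring : semi_ring_theory (0 : num) 1 (@add M) (@mul M) eq.
Proof.
  split; intros; auto using add0l, addC, addA, mul1l, mul0l, mulC, mulA, mulDl.
Qed.
Add Ring num_ring : num_semiring.

Lemma add_cancel (x y z : num) : x + z = y + z -> x = y.
Proof.
  ind3 (fun e : nat -> num => e 1%nat + e 0%nat = e 2%nat + e 0%nat -> e 1%nat = e 2%nat) x y x z.
  - now rewrite !add0.
  - rewrite !addS. intro H; apply IH, (ax_succ_inj ax), H.
Qed.

Lemma lt_addr (x y : num) : y < x + y + 1.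
Proof.
  ind3 (fun e : nat -> num => e 1%nat < e 0%nat + e 1%nat + 1) y y y x.
  - apply (ax_ltS ax); right; ring.
  - apply (ax_ltS ax); left. rewrite addSl; exact IH.
Qed.

Lemma lt_ex (x y : num) : x < y <-> exists d, y = x + d + 1.
Proof.
  split.
  - enough (H : ~ x < y \/ exists d, y = x + d + 1) by tauto.
    (* The first disjunct makes the base case trivial; for y = 0 the claim holds because
       nothing is below 0. *)
    pose (P := fun e : nat -> num => e 1%nat = 0 \/ ~ e 2%nat < e 1%nat \/ e 1%nat = e 2%nat + e 0%nat + 1).
    destruct (ind_ex some_sets P (scons x zeros)) with (n := y) as [d Hd].
    + unfold P; bounded_tac.
    + exists 0; left; reflexivity.
    + unfold P; cbn. intros n [d H].
      destruct (classic (x < n + 1)) as [Hx|Hx]; [|exists 0; auto].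
      apply (ax_ltS ax) in Hx. destruct Hx as [Hx|Hx].
      * destruct H as [H|[H|H]]; try tauto.
        -- subst n. elim (ax_lt0 ax Hx).
        -- exists (d + 1); right; right. rewrite H; ring.
      * subst. exists 0. right; right. ring.
    + unfold P in Hd; cbn in Hd. destruct Hd as [Hd|[Hd|Hd]]; eauto.
      left; subst; apply (ax_lt0 ax).
  - intros [d ->]. rewrite (addC x). apply lt_addr.
Qed.

Lemma zero_or_succ (x : num) : x = 0 \/ exists y, x = y + 1.
Proof.
  pose (P := fun e : nat -> num => e 1%nat = 0 \/ e 1%nat = e 0%nat + 1).
  destruct (ind_ex some_sets P zeros) with (n := x) as [d [Hd|Hd]]; cbn in *; eauto.
  - unfold P; bounded_tac.
  - exists 0; left; reflexivity.
  - intros n _; exists n; right; reflexivity.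
Qed.

Lemma le_ex (x y : num) : x <= y <-> exists d, y = x + d.
Proof.
  rewrite lt_ex; split.
  - intros [[d ->]| ->]; [exists (d + 1)|exists 0]; ring.
  - intros [d ->]. destruct (zero_or_succ d) as [->|[c ->]].
    + right; ring.
    + left; exists c; ring.
Qed.

Lemma lt_iff_succ_le (x y : num) : x < y <-> x + 1 <= y.
Proof.
  rewrite lt_ex, le_ex; split; intros [d ->]; exists d; ring.
Qed.

Lemma le_or_lt (x y : num) : x <= y \/ y < x.
Proof.
  ind3 (fun e : nat -> num => (e 0%nat < e 1%nat \/ e 0%nat = e 1%nat) \/ e 1%nat < e 0%nat) y y y x.
  - left; apply le_ex; exists y; ring.
  - destruct IH as [[H|H]|H].
    + left. apply lt_iff_succ_le, H.
    + right. apply lt_ex. exists 0; rewrite H; ring.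
    + right. apply lt_ex in H; destruct H as [d ->]. apply lt_ex; exists (d + 1); ring.
Qed.

Lemma le_contra (a b : num) : a <= b -> a = b + 1 -> False.
Proof.
  intros H ->. apply le_ex in H; destruct H as [d H].
  apply (ax_succ_neq0 ax (n := d)), (add_cancel _ _ b). rewrite H at 2. ring.
Qed.

Lemma le_add (a b c d : num) : a <= b -> c <= d -> a + c <= b + d.
Proof.
  rewrite !le_ex. intros [x ->] [y ->]; exists (x + y); ring.
Qed.

Lemma lin_le (x y a b : num) : a <= b -> y + a = x + b -> x <= y.
Proof.
  intros H E. destruct (le_or_lt x y) as [|L]; [assumption|exfalso].
  apply lt_iff_succ_le in L. apply (le_contra (y + 1 + a) (x + b)).
  - apply le_add; assumption.
  - rewrite <- E; ring.
Qed.
Lemma lin_lt (x y a b : num) : a <= b -> y + a = x + 1 + b -> x < y.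
Proof. intros H E; apply lt_iff_succ_le; eapply lin_le; eauto. Qed.
Lemma le_antisym (x y : num) : x <= y -> y <= x -> x = y.
Proof.
  intros [H|H] K; [exfalso|auto]. apply lt_iff_succ_le in H.
  apply (le_contra _ _ (le_add _ _ _ _ H K)); ring.
Qed.
Lemma le0 (x : num) : 0 <= x.
Proof. apply le_ex; exists x; ring. Qed.
Lemma le_refl (x : num) : x <= x. Proof. right; reflexivity. Qed.
Lemma eq_le (x y : num) : x = y -> x <= y. Proof. right; assumption. Qed.
Lemma lt_le (x y : num) : x < y -> x + 1 <= y. Proof. apply lt_iff_succ_le. Qed.

(* Linear arithmetic by explicit certificates.  The arguments of [lin] are
   inequalities or equations, an equation counting as left side <= right side.
   They are added up, and [ring] checks that the sum yields the goal exactly;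
   a missing slack is supplied by further arguments [le0 x], except for a slack
   of 1 or 2, which is tried automatically. *)
Ltac tole H := match type of H with
  | lt _ _ => constr:(lt_le _ _ H)
  | lt _ _ \/ _ => constr:(H)
  | @eq _ _ _ => constr:(eq_le _ _ H)
  end.
Ltac lin_exact S :=
  match goal with
  | |- lt _ _ => apply (lin_lt _ _ _ _ S); ring
  | |- lt _ _ \/ _ => apply (lin_le _ _ _ _ S); ring
  | |- _ => exfalso; apply (le_contra _ _ S); ring
  end.
Ltac lin_close S := first [ lin_exact S
  | lin_exact constr:(le_add _ _ _ _ S (le0 1)) | lin_exact constr:(le_add _ _ _ _ S (le0 (1 + 1))) ].
Tactic Notation "lin" := lin_close (le_refl 0).
Tactic Notation "lin" constr(A) := let a := tole A in lin_close a.
Ltac suml a b := constr:(le_add _ _ _ _ a b).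
Tactic Notation "lin" constr(A) constr(B) :=
  let a := tole A in let b := tole B in let s := suml a b in lin_close s.
Tactic Notation "lin" constr(A) constr(B) constr(C) :=
  let a := tole A in let b := tole B in let c := tole C in
  let s := suml a b in let s := suml s c in lin_close s.
Tactic Notation "lin" constr(A) constr(B) constr(C) constr(D) :=
  let a := tole A in let b := tole B in let c := tole C in let d := tole D in
  let s := suml a b in let s := suml s c in let s := suml s d in lin_close s.

Lemma lt_irrefl (x : num) : ~ x < x.
Proof. intro H; lin H. Qed.

(** * Pairing, and sets and functions of the model *)

Lemma lt_succ (x y : num) : x < y + 1 <-> x <= y.
Proof. apply (ax_ltS ax). Qed.
Lemma le_mul (a b c d : num) : a <= b -> c <= d -> a * c <= b * d.
Proof.
  rewrite !le_ex. intros [x ->] [y ->]. exists (a * y + x * c + x * y). ring.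
Qed.
Lemma le_trans (x y z : num) : x <= y -> y <= z -> x <= z.
Proof. intros H K. lin H K. Qed.
Lemma lt_le_trans (x y z : num) : x < y -> y <= z -> x < z.
Proof. intros H K. lin H K. Qed.
Lemma le_lt_trans (x y z : num) : x <= y -> y < z -> x < z.
Proof. intros H K. lin H K. Qed.
Lemma le_square (x : num) : x <= x * x.
Proof.
  destruct (zero_or_succ x) as [->|[y ->]].
  - right; ring.
  - lin (le0 (y * y)) (le0 y).
Qed.

Lemma pair_sum_le (i j i' j' : num) : pair i j = pair i' j' -> i' + j' <= i + j.
Proof.
  intro H. destruct (le_or_lt (i' + j') (i + j)) as [|L]; [assumption|].
  apply lt_le in L. pose proof (le_mul _ _ _ _ L L) as K.
  unfold pair in H. lin K (eq_sym H) (le0 (i + j + j + i')).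
Qed.
(** The sum i + j is the integer square root of the code, which determines
    it, and then i is the rest. *)
Lemma pair_inj (i j i' j' : num) : pair i j = pair i' j' -> i = i' /\ j = j'.
Proof.
  intro H. assert (E : i + j = i' + j').
  { apply le_antisym; apply pair_sum_le; auto. }
  unfold pair in H. rewrite E in H.
  assert (I : i = i').
  { apply (add_cancel _ _ ((i' + j') * (i' + j'))). rewrite !(addC _ (_ * _)). exact H. }
  split; [exact I|]. subst. apply (add_cancel _ _ i'). rewrite !(addC _ i'). exact E.
Qed.
Lemma pair_fst_le (i j : num) : i <= pair i j.
Proof. unfold pair. lin (le0 ((i + j) * (i + j))). Qed.
Lemma pair_snd_le (i j : num) : j <= pair i j.
Proof. unfold pair. lin (le_square (i + j)) (le0 i) (le0 i). Qed.

(** Predicates with several variables are treated as predicates of one number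
    that codes a tuple: P : num -> num -> Prop is represented by
    fun w => P (pfst w) (psnd w), with the projections defined below. *)
Definition is_set (P : num -> Prop) := exists X : sets, forall n, n in_ X <-> P n.
Definition is_fun (F : num -> num) :=
  exists X : sets, forall n m, pair n m in_ X <-> F n = m.

Ltac term_tac ::= unfold pair; repeat (cbv beta; first
  [ apply term_add | apply term_mul | apply term_zero | apply term_one | apply term_var ]).

(** Delta01 comprehension with one number parameter c.  Boundedness is
    required for all choices of variables, as A and B occur below under
    different numbers of quantifiers. *)
Lemma set_intro (P : num -> Prop) V (A B : num -> num -> num -> Prop) c :
  (forall i j k, bounded_def V (fun e => A (e i) (e j) (e k))) ->
  (forall i j k, bounded_def V (fun e => B (e i) (e j) (e k))) ->
  (forall n, P n <-> exists x, A c x n) ->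
  (forall n, P n <-> forall x, B c x n) -> is_set P.
Proof.
  intros HA HB KA KB.
  destruct (comprehension V (fun e => A (e 2%nat) (e 0%nat) (e 1%nat))
     (fun e => B (e 2%nat) (e 0%nat) (e 1%nat)) (scons c zeros)) as [X HX]; auto.
  - intro n; cbn. rewrite <- KA, <- KB. tauto.
  - exists X. intro n. rewrite HX, KA. cbn. tauto.
Qed.

(** A function with Sigma01 graph has a Delta01 graph: a pair (n, m) is outside
    of it iff some other value is attained at n.  In the universal formula z
    bounds both the competing value m' and its witness x. *)
Lemma fun_intro (F : num -> num) V (A : num -> num -> num -> num -> Prop) c :
  (forall i j k l, bounded_def V (fun e => A (e i) (e j) (e k) (e l))) ->
  (forall n m, F n = m <-> exists x, A c x n m) -> is_fun F.
Proof.
  intros HA KA.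
  destruct (set_intro (fun w => exists n m, w = pair n m /\ F n = m) V
    (fun c x w => exists n, n < w + 1 /\ exists m, m < w + 1 /\ w = pair n m /\ A c x n m)
    (fun c z w => exists n, n < w + 1 /\ exists m, m < w + 1 /\ w = pair n m /\
       forall m', m' < z -> forall x, x < z -> A c x n m' -> m' = m) c) as [X HX].
  - intros; bounded_tac; apply HA.
  - intros; bounded_tac; apply HA.
  - intro w; split.
    + intros [n [m [-> H]]]. apply KA in H; destruct H as [x H].
      exists x, n; split; [apply lt_succ, pair_fst_le|].
      exists m; split; [apply lt_succ, pair_snd_le|]. auto.
    + intros [x [n [_ [m [_ [E H]]]]]]. exists n, m; split; [exact E|].
      apply KA; eauto.
  - intro w; split.
    + intros [n [m [-> H]]] z.
      exists n; split; [apply lt_succ, pair_fst_le|].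
      exists m; split; [apply lt_succ, pair_snd_le|]. split; [reflexivity|].
      intros m' _ x _ H'. assert (F n = m') by (apply KA; eauto). congruence.
    + intro H.
      destruct (H 0) as [n [_ [m [_ [E _]]]]]. exists n, m; split; [exact E|].
      destruct (proj1 (KA n (F n)) eq_refl) as [x Hx].
      destruct (H (F n + x + 1)) as [n' [_ [m' [_ [E' H']]]]].
      rewrite E in E'. apply pair_inj in E'. destruct E' as [<- <-].
      apply (H' _) with x; [| |exact Hx].
      * lin (le0 x).
      * lin (le0 (F n)).
  - exists X. intros n m. rewrite HX. split.
    + intros [n' [m' [E H]]]. apply pair_inj in E. destruct E as [-> ->]. exact H.
    + intro H; eauto.
Qed.

Definition env2 (X Y : sets) : nat -> sets := scons X (fun _ => Y).

Lemma set_ext P Q : is_set P -> (forall n, P n <-> Q n) -> is_set Q.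
Proof. intros [X HX] H. exists X. intro n. rewrite HX. apply H. Qed.

Lemma fun_id : is_fun (fun n => n).
Proof.
  apply (fun_intro _ some_sets (fun _ _ n m => n = m) 0); [intros; bounded_tac|].
  intros n m; split; [intros; exists 0; auto|intros [_ H]; auto].
Qed.
Lemma fun_const c : is_fun (fun _ => c).
Proof.
  apply (fun_intro _ some_sets (fun c _ n m => c = m) c); [intros; bounded_tac|].
  intros n m; split; [intros; exists 0; auto|intros [_ H]; auto].
Qed.
(** The existential variable x bounds both arguments of [op]. *)
Lemma fun_op op F G :
  (forall V i j k, bounded_def V (fun e => op (e i) (e j) = e k)) ->
  is_fun F -> is_fun G -> is_fun (fun n => op (F n) (G n)).
Proof.
  intros Hop [X HX] [Y HY].
  pose (V := env2 X Y).
  apply (fun_intro _ V (fun _ x n m => exists a, a < x /\ exists b, b < x /\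
    pair n a in_ V 0%nat /\ pair n b in_ V 1%nat /\ op a b = m) 0).
  - intros; bounded_tac. apply Hop.
  - intros n m; split.
    + intro H. exists (F n + G n + 1), (F n). split; [lin (le0 (G n))|].
      exists (G n). split; [lin (le0 (F n))|].
      split; [apply HX|split; [apply HY|]]; auto.
    + intros [x [a [_ [b [_ [Ha [Hb H]]]]]]]. apply HX in Ha. apply HY in Hb. congruence.
Qed.
Lemma fun_add F G : is_fun F -> is_fun G -> is_fun (fun n => F n + G n).
Proof. apply fun_op. intros; bounded_tac. Qed.
Lemma fun_mul F G : is_fun F -> is_fun G -> is_fun (fun n => F n * G n).
Proof. apply fun_op. intros; bounded_tac. Qed.
Lemma fun_pair F G : is_fun F -> is_fun G -> is_fun (fun n => pair (F n) (G n)).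
Proof. apply fun_op. intros; bounded_tac. Qed.
Lemma fun_comp G F : is_fun G -> is_fun F -> is_fun (fun n => G (F n)).
Proof.
  intros [Y HY] [X HX].
  pose (V := env2 X Y).
  apply (fun_intro _ V (fun _ x n m => pair n x in_ V 0%nat /\ pair x m in_ V 1%nat) 0).
  - intros; bounded_tac.
  - intros n m; split.
    + intro H. exists (F n). split; [apply HX|apply HY]; auto.
    + intros [x [Ha Hb]]. apply HX in Ha. apply HY in Hb. congruence.
Qed.

(** Any proposition is allowed, however complex: classically the set is either
    empty or everything. *)
Lemma set_const (A : Prop) : is_set (fun _ => A).
Proof.
  destruct (classic A).
  - apply (set_intro _ some_sets (fun _ _ n => n = n) (fun _ _ n => n = n) 0);
      [intros; bounded_tac..| |]; intro; split; auto; exists 0; auto.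
  - apply (set_intro _ some_sets (fun _ _ n => n <> n) (fun _ _ n => n <> n) 0);
      [intros; bounded_tac..| |]; intro n; split; try tauto; intro K.
    destruct K as [_ K]; tauto.
Qed.
Lemma set_not P : is_set P -> is_set (fun n => ~ P n).
Proof.
  intros [X HX]. pose (V := env2 X X).
  apply (set_intro _ V (fun _ _ n => ~ n in_ V 0%nat) (fun _ _ n => ~ n in_ V 0%nat) 0);
    [intros; bounded_tac..| |]; intro n; unfold V, env2; cbn; specialize (HX n).
  - split; [intro H; exists 0; tauto|intros [_ H]; tauto].
  - split; [intros H _; tauto|intro H; specialize (H 0); tauto].
Qed.
Lemma set_and P Q : is_set P -> is_set Q -> is_set (fun n => P n /\ Q n).
Proof.
  intros [X HX] [Y HY]. pose (V := env2 X Y).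
  apply (set_intro _ V (fun _ _ n => n in_ V 0%nat /\ n in_ V 1%nat)
    (fun _ _ n => n in_ V 0%nat /\ n in_ V 1%nat) 0);
    [intros; bounded_tac..| |]; intro n; unfold V, env2; cbn; specialize (HX n); specialize (HY n).
  - split; [intro H; exists 0; tauto|intros [_ H]; tauto].
  - split; [intros H _; tauto|intro H; specialize (H 0); tauto].
Qed.
Lemma set_or P Q : is_set P -> is_set Q -> is_set (fun n => P n \/ Q n).
Proof.
  intros HP HQ. apply (set_ext (fun n => ~ (~ P n /\ ~ Q n))).
  - apply set_not, set_and; apply set_not; assumption.
  - intro n; tauto.
Qed.
Lemma set_imp P Q : is_set P -> is_set Q -> is_set (fun n => P n -> Q n).
Proof.
  intros HP HQ. apply (set_ext (fun n => ~ P n \/ Q n)).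
  - apply set_or; [apply set_not|]; assumption.
  - intro n; tauto.
Qed.
Lemma set_comp P F : is_set P -> is_fun F -> is_set (fun n => P (F n)).
Proof.
  intros [Y HY] [X HX]. pose (V := env2 X Y).
  apply (set_intro _ V (fun _ x n => pair n x in_ V 0%nat /\ x in_ V 1%nat)
    (fun _ x n => pair n x in_ V 0%nat -> x in_ V 1%nat) 0);
    [intros; bounded_tac..| |]; intro n; cbn.
  - split.
    + intro H. exists (F n). split; [apply HX|apply HY]; auto.
    + intros [x [Ha Hb]]. apply HX in Ha. apply HY in Hb. congruence.
  - split.
    + intros H x Hx. apply HX in Hx. apply HY. congruence.
    + intros H. apply HY, H, HX. reflexivity.
Qed.
Lemma set_mem F X : is_fun F -> is_set (fun n => F n in_ X).
Proof. apply (set_comp (fun n => n in_ X)). exists X; tauto. Qed.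
Lemma set_rel (R : num -> num -> Prop) F G :
  (forall V i j, bounded_def V (fun e => R (e i) (e j))) ->
  is_fun F -> is_fun G -> is_set (fun n => R (F n) (G n)).
Proof.
  intros HR' [X HX] [Y HY].
  pose (V := env2 X Y).
  apply (set_intro _ V (fun _ x n => exists a, a < x /\ exists b, b < x /\
    pair n a in_ V 0%nat /\ pair n b in_ V 1%nat /\ R a b)
    (fun _ x n => forall a, a < x -> forall b, b < x ->
    pair n a in_ V 0%nat -> pair n b in_ V 1%nat -> R a b) 0).
  - intros; bounded_tac. apply HR'.
  - intros; bounded_tac. apply HR'.
  - intros n; split.
    + intro H. exists (F n + G n + 1), (F n). split; [lin (le0 (G n))|].
      exists (G n). split; [lin (le0 (F n))|].
      split; [apply HX|split; [apply HY|]]; auto.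
    + intros [x [a [_ [b [_ [Ha [Hb H]]]]]]]. apply HX in Ha. apply HY in Hb. congruence.
  - intros n; split.
    + intros H x a _ b _ Ha Hb. apply HX in Ha. apply HY in Hb. congruence.
    + intros H. apply (H (F n + G n + 1)); [lin (le0 (G n))|lin (le0 (F n))|apply HX; auto|apply HY; auto].
Qed.
Lemma set_eq F G : is_fun F -> is_fun G -> is_set (fun n => F n = G n).
Proof. apply set_rel. intros; bounded_tac. Qed.
Lemma set_lt F G : is_fun F -> is_fun G -> is_set (fun n => F n < G n).
Proof. apply set_rel. intros; bounded_tac. Qed.

(* On numbers that are not pairs both projections take the value 0. *)
Definition unpair (w i j : num) :=
  w = pair i j \/ (~ exists i j, w = pair i j) /\ i = 0 /\ j = 0.
Definition pfst (w : num) := epsilon (inhabits 0) (fun i => exists j, unpair w i j).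
Definition psnd (w : num) := epsilon (inhabits 0) (fun j => unpair w (pfst w) j).

Lemma unpair_spec w : unpair w (pfst w) (psnd w).
Proof.
  unfold psnd. apply epsilon_spec. unfold pfst. apply epsilon_spec.
  destruct (classic (exists i j, w = pair i j)) as [[i [j H]]|H].
  - exists i, j. left; exact H.
  - exists 0, 0. right; auto.
Qed.
Lemma unpair_inj w i j i' j' : unpair w i j -> unpair w i' j' -> i = i' /\ j = j'.
Proof.
  intros [H|[H [-> ->]]] [K|[K [-> ->]]].
  - apply pair_inj; congruence.
  - elim K; eauto.
  - elim H; eauto.
  - auto.
Qed.
Lemma pfst_pair i j : pfst (pair i j) = i.
Proof. apply (unpair_inj (pair i j) _ _ i j (unpair_spec _)). left; reflexivity. Qed.
Lemma psnd_pair i j : psnd (pair i j) = j.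
Proof. apply (unpair_inj (pair i j) _ _ i j (unpair_spec _)). left; reflexivity. Qed.

(** A bounded formula for [unpair]. *)
Definition bunpair (w i j : num) :=
  w = pair i j \/ (forall i, i < w + 1 -> forall j, j < w + 1 -> w <> pair i j) /\ i = 0 /\ j = 0.
Lemma bunpair_iff w i j : bunpair w i j <-> unpair w i j.
Proof.
  unfold bunpair, unpair. split; intros [H|[H K]]; auto; right; split; auto.
  - intros [i' [j' ->]]. apply (H i') with j'; auto; apply lt_succ; auto using pair_fst_le, pair_snd_le.
  - intros i' _ j' _ E. eauto.
Qed.
Lemma fun_pfst0 : is_fun pfst.
Proof.
  apply (fun_intro _ some_sets (fun _ x n m => bunpair n m x) 0).
  - intros; unfold bunpair; bounded_tac.
  - intros n m; split.
    + intros <-. exists (psnd n). apply bunpair_iff, unpair_spec.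
    + intros [x Hx]. apply bunpair_iff in Hx. apply (unpair_inj _ _ _ _ _ (unpair_spec n) Hx).
Qed.
Lemma fun_psnd0 : is_fun psnd.
Proof.
  apply (fun_intro _ some_sets (fun _ x n m => bunpair n x m) 0).
  - intros; unfold bunpair; bounded_tac.
  - intros n m; split.
    + intros <-. exists (pfst n). apply bunpair_iff, unpair_spec.
    + intros [x Hx]. apply bunpair_iff in Hx. apply (unpair_inj _ _ _ _ _ (unpair_spec n) Hx).
Qed.
Lemma fun_pfst F : is_fun F -> is_fun (fun n => pfst (F n)).
Proof. apply fun_comp, fun_pfst0. Qed.
Lemma fun_psnd F : is_fun F -> is_fun (fun n => psnd (F n)).
Proof. apply fun_comp, fun_psnd0. Qed.

Lemma set_bex F P : is_fun F -> is_set (fun w => P (pfst w) (psnd w)) ->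
  is_set (fun n => exists x, x < F n /\ P n x).
Proof.
  intros [X HX] [Y HY]. pose (V := env2 X Y).
  assert (K : forall n x, pair n x in_ Y <-> P n x).
  { intros n x; rewrite HY, pfst_pair, psnd_pair; tauto. }
  apply (set_intro _ V (fun _ b n => pair n b in_ V 0%nat /\ exists x, x < b /\ pair n x in_ V 1%nat)
    (fun _ b n => pair n b in_ V 0%nat -> exists x, x < b /\ pair n x in_ V 1%nat) 0);
    [intros; bounded_tac..| |]; intro n; cbn; (split; [intros [x [H1 H2]]|]).
  - exists (F n). split; [apply HX; reflexivity|]. exists x; split; [assumption|]. apply K; assumption.
  - intros [b [Hb [x [H1 H2]]]]. exists x. apply HX in Hb; subst b. split; [assumption|apply K; assumption].
  - intros b Hb. apply HX in Hb; subst b. exists x; split; [assumption|]. apply K; assumption.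
  - intro H. destruct (H (F n)) as [x [H1 H2]]; [apply HX; reflexivity|].
    exists x; split; [assumption|]. apply K; assumption.
Qed.
Lemma set_ball F P : is_fun F -> is_set (fun w => P (pfst w) (psnd w)) ->
  is_set (fun n => forall x, x < F n -> P n x).
Proof.
  intros HF HP. apply (set_ext (fun n => ~ exists x, x < F n /\ ~ P n x)).
  - apply set_not, set_bex; [assumption|]. apply set_not; assumption.
  - intro n; split.
    + intros H x Hx. apply NNPP. intro K; apply H; eauto.
    + intros H [x [K1 K2]]; auto.
Qed.
Lemma set_rel2 (R : num -> num -> Prop) F G : is_set (fun w => R (pfst w) (psnd w)) ->
  is_fun F -> is_fun G -> is_set (fun n => R (F n) (G n)).
Proof.
  intros HR' HF HG. apply (set_ext (fun n => R (pfst (pair (F n) (G n))) (psnd (pair (F n) (G n))))).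
  - apply (set_comp (fun w => R (pfst w) (psnd w))); [assumption|]. apply fun_pair; assumption.
  - intro n. rewrite pfst_pair, psnd_pair. tauto.
Qed.
Lemma fun_rel2 (H : num -> num -> num) F G : is_fun (fun w => H (pfst w) (psnd w)) ->
  is_fun F -> is_fun G -> is_fun (fun n => H (F n) (G n)).
Proof.
  intros HH HF HG.
  destruct (fun_comp _ _ HH (fun_pair _ _ HF HG)) as [X HX].
  exists X. intros n m. rewrite HX, pfst_pair, psnd_pair. tauto.
Qed.

Lemma set_iff P Q : is_set P -> is_set Q -> is_set (fun n => P n <-> Q n).
Proof. intros HP HQ. apply set_and; apply set_imp; assumption. Qed.

Ltac definable_quantifier := fail.
(* [definable] proves goals [is_set P] and [is_fun F] by following the syntax
   of P and F.  Functions and relations of the development are recognised by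
   the facts about them in the context, where [Let] puts them.  [definable_quantifier] is a hook for
   unbounded quantifiers, which need arithmetical comprehension.  What cannot be
   solved is left as a subgoal. *)
Ltac eta_expand := cbv beta; lazymatch goal with
  | |- is_fun (fun _ => _) => idtac
  | |- is_fun ?F => change (is_fun (fun n => F n))
  | |- is_set (fun _ => _) => idtac
  | |- is_set ?P => change (is_set (fun n => P n))
  end.
Ltac definable := eta_expand; first
  [ apply fun_const | apply fun_id | apply set_const
  | lazymatch goal with
    | |- is_fun (fun w => pfst (@?F w)) => apply fun_pfst
    | |- is_fun (fun w => psnd (@?F w)) => apply fun_psnd
    | |- is_fun (fun w => pair (@?F w) (@?G w)) => apply fun_pair
    | |- is_fun (fun w => @?F w + @?G w) => apply fun_add
    | |- is_fun (fun w => @?F w * @?G w) => apply fun_mul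
    | |- is_set (fun w => @?F w = @?G w) => apply set_eq
    | |- is_set (fun w => @?F w < @?G w) => apply set_lt
    | |- is_set (fun w => @?F w in_ _) => apply set_mem
    | |- is_set (fun w => ~ @?P w) => apply set_not
    | |- is_set (fun w => @?P w /\ @?Q w) => apply set_and
    | |- is_set (fun w => @?P w \/ @?Q w) => apply set_or
    | |- is_set (fun w => @?P w <-> @?Q w) => apply set_iff
    end; definable
  | match goal with
    | H : is_fun ?F |- is_fun (fun w => ?F w) => exact H
    | H : is_set ?P |- is_set (fun w => ?P w) => exact H
    | H : is_fun ?F |- is_fun (fun w => ?F (@?G w)) => apply (fun_comp F G H)
    | H : is_fun (fun w => ?F (pfst w) (psnd w)) |- is_fun (fun w => ?F (@?G w) (@?K w)) =>
        apply (fun_rel2 F G K H)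
    | H : is_set ?P |- is_set (fun w => ?P (@?G w)) => apply (set_comp P G H)
    | H : is_set (fun w => ?P (pfst w) (psnd w)) |- is_set (fun w => ?P (@?G w) (@?K w)) =>
        apply (set_rel2 P G K H)
    end; definable
  | lazymatch goal with
    | |- is_set (fun w => exists x, _ < _ /\ _) => apply set_bex
    | |- is_set (fun w => forall x : Defs.num _, _ < _ -> _) => apply set_ball
    | |- is_set (fun w => _ -> _) => apply set_imp
    end; definable
  | definable_quantifier; definable
  | idtac ].

(** * Induction, least elements and minimization *)

Lemma set_ind P : is_set P -> P 0 -> (forall n, P n -> P (n + 1)) -> forall n, P n.
Proof.
  intros [X HX] H0 HS n. pose (V := env2 X X).
  apply HX. refine (ind_bounded V (fun e => e 0%nat in_ V 0%nat) zeros _ _ _ n).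
  - bounded_tac.
  - apply HX, H0.
  - intros m Hm. apply HX, HS, HX, Hm.
Qed.
Lemma sig_ind (R : num -> num -> Prop) : is_set (fun w => R (pfst w) (psnd w)) ->
  (exists x, R 0 x) -> (forall n, (exists x, R n x) -> exists x, R (n + 1) x) ->
  forall n, exists x, R n x.
Proof.
  intros [X HX] H0 HS n. pose (V := env2 X X).
  assert (K : forall n x, pair n x in_ X <-> R n x).
  { intros m x; rewrite HX, pfst_pair, psnd_pair; tauto. }
  destruct (ind_ex V (fun e => pair (e 1%nat) (e 0%nat) in_ V 0%nat) zeros) with (n := n) as [x Hx].
  - bounded_tac.
  - destruct H0 as [x Hx]; exists x; apply K, Hx.
  - intros m [x Hx]. destruct (HS m) as [y Hy]; [exists x; apply K, Hx|exists y; apply K, Hy].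
  - exists x. apply K, Hx.
Qed.
Lemma strong_ind P : is_set P -> (forall n, (forall m, m < n -> P m) -> P n) -> forall n, P n.
Proof.
  intros HP H n. apply H. revert n.
  apply (set_ind (fun n => forall m, m < n -> P m)).
  - definable.
  - intros m K; elim (ax_lt0 ax K).
  - intros n IH m K. apply lt_succ in K. destruct K as [K| ->]; auto.
Qed.
Lemma least P n : is_set P -> P n -> exists m, P m /\ forall k, k < m -> ~ P k.
Proof.
  intros HP Hn. apply NNPP. intro H. revert Hn.
  apply (strong_ind (fun n => ~ P n)); [definable|].
  intros m K Hm. apply H. eauto.
Qed.

(* The induction predicate is read off from the goal [forall i, P i]. *)
Ltac induct lem := lazymatch goal with |- forall i, @?P i => apply (lem P); cbv beta end.

Definition minimize (R : num -> num -> Prop) n :=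
  epsilon (inhabits 0) (fun x => R n x /\ forall y, y < x -> ~ R n y).
Lemma minimize_spec R : is_set (fun w => R (pfst w) (psnd w)) -> forall n, (exists x, R n x) ->
  R n (minimize R n) /\ forall y, y < minimize R n -> ~ R n y.
Proof.
  intros HR' n [x Hx]. unfold minimize. apply epsilon_spec.
  apply (least (fun x => R n x) x); [definable|exact Hx].
Qed.
Lemma least_uniq (P : num -> Prop) x y : (P x /\ forall z, z < x -> ~ P z) ->
  (P y /\ forall z, z < y -> ~ P z) -> x = y.
Proof.
  intros [A B] [C D]. apply le_antisym.
  - destruct (le_or_lt x y); auto. elim (B y); auto.
  - destruct (le_or_lt y x); auto. elim (D x); auto.
Qed.
Lemma fun_graph F : is_set (fun w => F (pfst w) = psnd w) -> is_fun F.
Proof.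
  intros [X HX]. exists X. intros n m. rewrite HX, pfst_pair, psnd_pair. tauto.
Qed.
Lemma fun_minimize R : is_set (fun w => R (pfst w) (psnd w)) -> (forall n, exists x, R n x) -> is_fun (minimize R).
Proof.
  intros HR' H. apply fun_graph.
  apply (set_ext (fun w => R (pfst w) (psnd w) /\ forall y, y < psnd w -> ~ R (pfst w) y)).
  - definable.
  - intro w. split.
    + intro K. apply (least_uniq (R (pfst w))); [apply minimize_spec|]; auto.
    + intros <-. apply minimize_spec; auto.
Qed.

(** * Remainders and Goedel's beta function *)

Lemma lt_or_le (x y : num) : x < y \/ y <= x.
Proof. destruct (le_or_lt y x); auto. Qed.

Lemma div_le (m q r q' r' : num) : r < m -> q * m + r = q' * m + r' -> q' <= q.
Proof.
  intros Hr H. destruct (le_or_lt q' q) as [|L]; auto.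
  apply lt_ex in L. destruct L as [d ->].
  lin Hr (eq_sym H) (le0 (d * m + r')).
Qed.
Lemma div_uniq (m q r q' r' : num) : r < m -> r' < m -> q * m + r = q' * m + r' -> q = q' /\ r = r'.
Proof.
  intros Hr Hr' H. assert (q = q') as <-.
  { apply le_antisym; [apply (div_le m q' r' q r)|apply (div_le m q r q' r')]; auto. }
  split; auto. apply (add_cancel _ _ (q * m)). rewrite !(addC _ (q * m)). exact H.
Qed.

Definition rem_rel (w r : num) := exists q, q < pfst w + 1 /\ pfst w = q * psnd w + r.
(** Taking the least remainder makes [rem] total; for m = 0 it is a itself. *)
Definition rem (a m : num) := minimize rem_rel (pair a m).
Let set_rem_rel : is_set (fun w => rem_rel (pfst w) (psnd w)).
Proof. unfold rem_rel. definable. Qed.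
Lemma rem_rel_ex w : exists r, rem_rel w r.
Proof. exists (pfst w), 0. split; [lin (le0 (pfst w))|ring]. Qed.
Let fun_rem : is_fun (fun w => rem (pfst w) (psnd w)).
Proof. pose proof (fun_minimize _ set_rem_rel rem_rel_ex). unfold rem. definable. Qed.
Lemma rem_eq a m : exists q, a = q * m + rem a m.
Proof.
  destruct (minimize_spec _ set_rem_rel _ (rem_rel_ex (pair a m))) as [[q [_ H]] _].
  exists q. rewrite pfst_pair, psnd_pair in H. exact H.
Qed.
Lemma rem_lt a m : 0 < m -> rem a m < m.
Proof.
  intro Hm. destruct (lt_or_le (rem a m) m) as [|L]; auto. exfalso.
  destruct (minimize_spec _ set_rem_rel _ (rem_rel_ex (pair a m))) as [[q [_ H]] K].
  fold (rem a m) in H, K. rewrite pfst_pair, psnd_pair in H.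
  apply le_ex in L. destruct L as [d L]. apply (K d).
  - lin Hm (eq_sym L).
  - exists (q + 1). rewrite pfst_pair, psnd_pair. rewrite H, L. split; [|ring].
    assert (X : 1 <= m) by lin Hm. pose proof (le_mul _ _ _ _ (le_refl q) X).
    lin H0 Hm (le0 d).
Qed.
Lemma rem_le a m : rem a m <= a.
Proof. destruct (rem_eq a m) as [q H]. lin (eq_sym H) (le0 (q * m)). Qed.

Definition cong (a b m : num) := exists p q, a + p * m = b + q * m.
Lemma cong_sym a b m : cong a b m -> cong b a m.
Proof. intros [p [q H]]; exists q, p; auto. Qed.
Lemma cong_trans a b c m : cong a b m -> cong b c m -> cong a c m.
Proof.
  intros [p [q H]] [p' [q' K]]. exists (p + p'), (q + q').
  transitivity (a + p * m + p' * m); [ring|]. rewrite H.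
  transitivity (b + p' * m + q * m); [ring|]. rewrite K. ring.
Qed.
Lemma cong_mul a b c m : cong a b m -> cong (c * a) (c * b) m.
Proof.
  intros [p [q H]]. exists (c * p), (c * q).
  transitivity (c * (a + p * m)); [ring|]. rewrite H. ring.
Qed.
Lemma cong_add a b c m : cong a b m -> cong (c + a) (c + b) m.
Proof.
  intros [p [q H]]. exists p, q.
  transitivity (c + (a + p * m)); [ring|]. rewrite H. ring.
Qed.
Lemma cong_rem a m : cong (rem a m) a m.
Proof. destruct (rem_eq a m) as [q H]. exists q, 0. rewrite H at 2. ring. Qed.
Lemma cong_lt a b m : a < m -> b < m -> cong a b m -> a = b.
Proof.
  intros Ha Hb [p [q H]]. eapply (div_uniq m p a q b); auto.
  rewrite !(addC (_ * m)). exact H.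
Qed.
Lemma rem_cong a b m : 0 < m -> cong a b m -> rem a m = rem b m.
Proof.
  intros Hm H. apply (cong_lt _ _ m); auto using rem_lt.
  eapply cong_trans; [apply cong_rem|]. eapply cong_trans; [exact H|].
  apply cong_sym, cong_rem.
Qed.
Lemma rem_small a m : a < m -> rem a m = a.
Proof.
  intro H. apply (cong_lt _ _ m); auto using cong_rem.
  apply rem_lt. lin H (le0 a).
Qed.
Lemma rem_uniq a v m : v < m -> cong a v m -> rem a m = v.
Proof.
  intros Hv H. rewrite (rem_cong a v); auto using rem_small. lin Hv (le0 v).
Qed.

(** The factorial of n, obtained by Sigma01 induction. *)
Lemma common_multiple (n : num) : exists b : num, 0 < b /\ forall x, x < n -> exists q, b = (x + 1) * q.
Proof.
  enough (K : exists b : num, 0 < b /\ forall x, x < n -> exists q, q < b + 1 /\ b = (x + 1) * q).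
  { destruct K as [b [Hb K]]. exists b. split; auto. intros x Hx. destruct (K x Hx) as [q [_ H]]; eauto. }
  revert n. apply (sig_ind (fun n b : num => 0 < b /\ forall x, x < n -> exists q, q < b + 1 /\ b = (x + 1) * q)).
  - definable.
  - exists 1. split; [lin|]. intros x K; elim (ax_lt0 ax K).
  - intros n [b [Hb K]]. exists (b * (n + 1)).
    assert (Hb' : b <= b * (n + 1)).
    { apply le_ex. exists (b * n). ring. }
    split; [lin Hb Hb'|]. intros x Hx. apply lt_succ in Hx. destruct Hx as [Hx| ->].
    + destruct (K x Hx) as [q [Hq E]]. exists (q * (n + 1)). split; [|rewrite E; ring].
      apply lt_succ. apply le_mul; [apply lt_succ, Hq|apply le_refl].
    + exists b. split; [lin Hb'|ring].
Qed.

(** Coprimality of D and m, in the form in which the Chinese remainder theorem uses it. *)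
Definition mod_inv (D m : num) := exists u, cong (u * D) 1 m.
Lemma mod_inv_mul D E m : mod_inv D m -> mod_inv E m -> mod_inv (D * E) m.
Proof.
  intros [u Hu] [v Hv]. exists (u * v).
  apply (cong_trans _ ((v * E) * 1)).
  - apply (cong_mul _ _ (v * E)) in Hu. replace (u * v * (D * E)) with (v * E * (u * D)) by ring. exact Hu.
  - replace (v * E * 1) with (v * E) by ring. exact Hv.
Qed.
Lemma mod_inv_bounded D m : 1 < m ->
  mod_inv D m <-> exists u, u < m /\ rem (u * D) m = 1.
Proof.
  intro Hm. assert (0 < m) by lin Hm. split.
  - intros [u Hu]. exists (rem u m). split; [apply rem_lt; auto|].
    apply rem_uniq; auto. apply (cong_trans _ (u * D)); auto.
    rewrite !(mulC _ D). apply cong_mul, cong_rem.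
  - intros [u [_ Hu]]. exists u. rewrite <- Hu. apply cong_sym, cong_rem.
Qed.
(** The modulus is written d + 1, so that - a can be replaced by d * a. *)
Lemma crt_step a D d v : mod_inv D (d + 1) -> exists t, cong (a + t * D) v (d + 1).
Proof.
  intros [u Hu]. exists (u * (v + d * a)).
  apply (cong_trans _ (a + (v + d * a) * 1)).
  - apply cong_add. replace (u * (v + d * a) * D) with ((v + d * a) * (u * D)) by ring.
    apply cong_mul; auto.
  - exists 0, a. ring.
Qed.

Definition modulus (b i : num) := 1 + (i + 1) * b.
Definition bseq (c i : num) := rem (pfst c) (modulus (psnd c) i).
Let fun_bseq : is_fun (fun w => bseq (pfst w) (psnd w)).
Proof. unfold bseq, modulus. definable. Qed.

(** Let K = k + 1, X = x + 1 and J = K + X.  Then J times modulus k minus K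
    times modulus k + x + 1 equals X, which divides b, and J * b is -1 modulo
    modulus k + x + 1.  This gives the inverse J^3 * b * q. *)
Lemma modulus_inv b k x q : b = (x + 1) * q -> mod_inv (modulus b k) (modulus b (k + x + 1)).
Proof.
  intros ->. unfold modulus. set (K := k + 1). set (J := k + x + 1 + 1). set (b := (x + 1) * q).
  exists (J * J * J * b * q). exists 1, (J * J * b * q * K + J * b).
  unfold K, J, b. ring.
Qed.

Lemma modulus_pos b i : 0 < modulus b i.
Proof. unfold modulus. lin (le0 ((i + 1) * b)). Qed.

(** By induction on k <= n: the pair w consists of a solution of the first k
    congruences and of a common multiple of the first k moduli, which has to
    stay coprime to the remaining ones. *)
Lemma crt c n b (Hb : 0 < b) : (forall x, x < n -> exists q, b = (x + 1) * q) ->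
  (forall i, i < n -> bseq c i < modulus b i) ->
  exists a D, (forall i, i < n -> rem a (modulus b i) = bseq c i) /\
    (forall i, i < n -> rem D (modulus b i) = 0) /\ mod_inv D (modulus b n).
Proof.
  intros Hdiv Hsmall.
  assert (Hmod : forall i, 1 < modulus b i).
  { intro i. unfold modulus. lin Hb (le0 (i * b)). }
  set (Inv := fun D j => exists u, u < modulus b j /\ rem (u * D) (modulus b j) = 1).
  assert (HInv : forall D j, Inv D j <-> mod_inv D (modulus b j)).
  { intros; unfold Inv; symmetry; apply mod_inv_bounded; auto. }
  assert (G : forall k, exists w, k <= n -> (forall i, i < k -> rem (pfst w) (modulus b i) = bseq c i) /\
    (forall i, i < k -> rem (psnd w) (modulus b i) = 0) /\
    forall j, j < n + 1 -> k <= j -> Inv (psnd w) j).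
  { apply (sig_ind (fun k w => k <= n -> (forall i, i < k -> rem (pfst w) (modulus b i) = bseq c i) /\
    (forall i, i < k -> rem (psnd w) (modulus b i) = 0) /\
    forall j, j < n + 1 -> k <= j -> Inv (psnd w) j)).
    - unfold Inv, modulus. definable.
    - exists (pair 0 1). intros _. rewrite pfst_pair, psnd_pair. repeat split.
      + intros i K; elim (ax_lt0 ax K).
      + intros i K; elim (ax_lt0 ax K).
      + intros j _ _. apply HInv. exists 1. exists 0, 0. ring.
    - intros k [w Hw]. destruct (lt_or_le n (k + 1)) as [L|L].
      { exists 0. intro K. lin L K. }
      destruct Hw as [Ha [HD Hi]]; [lin L|].
      set (a := pfst w) in *. set (D := psnd w) in *.
      assert (Hk : mod_inv D (modulus b k)).
      { apply HInv, Hi; [lin L|apply le_refl]. }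
      assert (E : modulus b k = (k + 1) * b + 1) by (unfold modulus; ring).
      rewrite E in Hk. destruct (crt_step a D _ (bseq c k) Hk) as [t Ht]. rewrite <- E in Ht.
      exists (pair (a + t * D) (D * modulus b k)). intros _. rewrite pfst_pair, psnd_pair. repeat split.
      + intros i Hi'. apply lt_succ in Hi'. destruct Hi' as [Hi'| ->].
        * rewrite <- Ha by auto. apply rem_cong; [apply modulus_pos|].
          apply (cong_trans _ (a + t * 0)).
          -- apply cong_add, cong_mul. rewrite <- (HD i) by auto. apply cong_sym, cong_rem.
          -- exists 0, 0; ring.
        * apply rem_uniq; auto. apply Hsmall. lin L.
      + intros i Hi'. apply rem_uniq; [apply modulus_pos|]. apply lt_succ in Hi'. destruct Hi' as [Hi'| ->].
        * apply (cong_trans _ (modulus b k * 0)).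
          -- rewrite (mulC D). apply cong_mul. rewrite <- (HD i) by auto. apply cong_sym, cong_rem.
          -- exists 0, 0; ring.
        * exists 0, D. ring.
      + intros j Hj Hkj. apply HInv, mod_inv_mul.
        * apply HInv, Hi; auto. lin Hkj.
        * apply le_ex in Hkj. destruct Hkj as [x ->].
          destruct (Hdiv x) as [q Hq].
          { apply lt_succ in Hj. lin Hj (le0 k). }
          replace (k + 1 + x) with (k + x + 1) by ring. apply (modulus_inv _ _ _ q Hq). }
  destruct (G n) as [w Hw]. destruct (Hw (le_refl n)) as [Ha [HD Hi]].
  exists (pfst w), (psnd w). repeat split; auto.
  apply HInv, Hi; [lin|apply le_refl].
Qed.

(** With b divisible by 1, ..., n and larger than all entries, the moduli are
    pairwise coprime and can carry the old entries and the new one. *)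
Lemma bseq_append c n v : exists c', (forall i, i < n -> bseq c' i = bseq c i) /\ bseq c' n = v.
Proof.
  destruct (common_multiple n) as [b0 [Hb0 H0]].
  set (b := b0 * (pfst c + v + 1)).
  assert (Hb : pfst c + v + 1 <= b).
  { assert (K : 1 <= b0) by lin Hb0.
    pose proof (le_mul _ _ _ _ K (le_refl (pfst c + v + 1))) as K'. unfold b. lin K'. }
  assert (Hm : forall i, pfst c + v + 1 <= modulus b i).
  { intro i. unfold modulus. lin Hb (le0 (i * b)). }
  destruct (crt c n b) as [a [D [Ha [HD Hi]]]].
  - lin Hb (le0 (pfst c + v)).
  - intros x Hx. destruct (H0 x Hx) as [q Hq]. exists (q * (pfst c + v + 1)).
    unfold b. rewrite Hq at 1. ring.
  - intros i _. pose proof (rem_le (pfst c) (modulus (psnd c) i)) as K. unfold bseq.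
    lin K (Hm i) (le0 v).
  - assert (E : modulus b n = (n + 1) * b + 1) by (unfold modulus; ring).
    rewrite E in Hi. destruct (crt_step a D _ v Hi) as [t Ht]. rewrite <- E in Ht.
    exists (pair (a + t * D) b). unfold bseq at 1 3. rewrite pfst_pair, psnd_pair. split.
    + intros i Hi'. rewrite <- Ha by auto. apply rem_cong; [apply modulus_pos|].
      apply (cong_trans _ (a + t * 0)).
      * apply cong_add, cong_mul. rewrite <- (HD i) by auto. apply cong_sym, cong_rem.
      * exists 0, 0; ring.
    + apply rem_uniq; auto. lin (Hm n) (le0 (pfst c)).
Qed.

(** * Primitive recursion *)

Section PrimRec.
Variables F0 G : num -> num.
Hypothesis HF0 : is_fun F0.
Hypothesis HG : is_fun G.

(** The number c codes a computation of length [psnd w] at the parameter [pfst w]. *)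
Definition history (w c : num) := bseq c 0 = F0 (pfst w) /\
  forall i, i < psnd w -> bseq c (i + 1) = G (pair (pair (pfst w) i) (bseq c i)).
Definition primrec (p n : num) := bseq (minimize history (pair p n)) n.

Lemma set_history : is_set (fun w => history (pfst w) (psnd w)).
Proof. unfold history. definable. Qed.
Lemma history_ex w : exists c, history w c.
Proof.
  unfold history. generalize (psnd w). intro n. set (p := pfst w). revert n.
  apply (sig_ind (fun n c => bseq c 0 = F0 p /\
    forall i, i < n -> bseq c (i + 1) = G (pair (pair p i) (bseq c i)))).
  - definable.
  - destruct (bseq_append 0 0 (F0 p)) as [c [_ H]]. exists c. split; auto.
    intros i K; elim (ax_lt0 ax K).
  - intros n [c [H0 HS]].
    destruct (bseq_append c (n + 1) (G (pair (pair p n) (bseq c n)))) as [c' [K1 K2]].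
    exists c'. split.
    + rewrite K1; auto. lin (le0 n).
    + intros i Hi. apply lt_succ in Hi. destruct Hi as [Hi| ->].
      * rewrite !K1; [auto|lin Hi|lin Hi].
      * rewrite K2, K1; [auto|lin].
Qed.
(** The value does not depend on the code of the computation that is found first. *)
Lemma history_agree p n n' c c' : history (pair p n) c -> history (pair p n') c' ->
  forall i, i <= n -> i <= n' -> bseq c i = bseq c' i.
Proof.
  unfold history. rewrite !pfst_pair, !psnd_pair. intros [A B] [A' B'].
  apply (set_ind (fun i => i <= n -> i <= n' -> bseq c i = bseq c' i)).
  - definable.
  - intros _ _. congruence.
  - intros i IH L L'. rewrite B, B', IH; [reflexivity|lin L|lin L'|lin L'|lin L].
Qed.
Lemma primrec_0 p : primrec p 0 = F0 p.
Proof.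
  unfold primrec. destruct (minimize_spec _ set_history _ (history_ex (pair p 0))) as [[H _] _].
  rewrite H, pfst_pair. reflexivity.
Qed.
Lemma primrec_S p n : primrec p (n + 1) = G (pair (pair p n) (primrec p n)).
Proof.
  unfold primrec. destruct (minimize_spec _ set_history _ (history_ex (pair p n))) as [H _].
  destruct (minimize_spec _ set_history _ (history_ex (pair p (n + 1)))) as [H' _].
  rewrite (history_agree p n (n + 1) _ _ H H'); [|apply le_refl|lin].
  destruct H' as [_ H']. rewrite pfst_pair, psnd_pair in H'. apply H'. lin.
Qed.
Lemma fun_primrec : is_fun (fun w => primrec (pfst w) (psnd w)).
Proof. pose proof (fun_minimize _ set_history history_ex). unfold primrec. definable. Qed.
End PrimRec.
Implicit Types s t u l i : num.

(** * Powers of two and binary strings *)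

Definition exp2 (l : num) : num := primrec (fun _ => 1) (fun w => psnd w + psnd w) 0 l.
Lemma exp2_0 : exp2 0 = 1.
Proof. unfold exp2. rewrite primrec_0; auto; definable. Qed.
Lemma exp2_S l : exp2 (l + 1) = exp2 l + exp2 l.
Proof. unfold exp2. rewrite primrec_S; [|definable..]. rewrite psnd_pair. reflexivity. Qed.
Let fun_exp2 : is_fun exp2.
Proof.
  pose proof (fun_primrec (fun _ => 1) (fun w => psnd w + psnd w) ltac:(definable) ltac:(definable)).
  unfold exp2. definable.
Qed.

Lemma lt_exp2 l : l < exp2 l.
Proof.
  revert l. induct set_ind; [definable|rewrite exp2_0; lin|].
  intros n IH. rewrite exp2_S. lin IH IH (le0 n).
Qed.
Lemma exp2_pos l : 0 < exp2 l.
Proof. lin (lt_exp2 l) (le0 l). Qed.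
Lemma exp2_mono l k : exp2 l + exp2 l <= exp2 (l + k + 1).
Proof.
  revert k. induct set_ind; [definable| |].
  - rewrite add0, exp2_S. apply le_refl.
  - intros k IH. replace (l + (k + 1) + 1) with (l + k + 1 + 1) by ring.
    rewrite exp2_S. lin IH (le0 (exp2 (l + k + 1))).
Qed.
Lemma exp2_lt l k : l < k -> exp2 l + exp2 l <= exp2 k.
Proof. intro H. apply lt_ex in H. destruct H as [d ->]. lin (exp2_mono l d). Qed.

Lemma beta_bseq a b i r : beta a b i r <-> r = bseq (pair a b) i.
Proof.
  unfold bseq. rewrite pfst_pair, psnd_pair. split.
  - intros [H [q K]]. symmetry. apply rem_uniq; [exact H|]. rewrite K. exists 0, q.
    unfold modulus. ring.
  - intros ->. split; [apply rem_lt, modulus_pos|]. apply rem_eq.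
Qed.
Lemma pow2_iff l p : pow2 l p <-> p = exp2 l.
Proof.
  split.
  - intros [a [b [H0 [HS Hl]]]]. apply beta_bseq in H0, Hl. rewrite Hl.
    enough (K : forall i, i <= l -> bseq (pair a b) i = exp2 i) by (apply K, le_refl).
    induct set_ind; [definable|rewrite exp2_0; auto|].
    intros i IH L. destruct (HS i) as [r [H1 H2]]; [lin L|].
    apply beta_bseq in H1, H2. rewrite <- H2, exp2_S, <- IH by lin L. congruence.
  - intros ->. set (F0 := fun _ : num => 1 : num). set (G := fun w : num => psnd w + psnd w).
    assert (HF0 : is_fun F0) by (unfold F0; definable). assert (HG : is_fun G) by (unfold G; definable).
    destruct (minimize_spec _ (set_history _ _ HF0 HG) _ (history_ex F0 G HG (pair 0 l))) as [[A B] _].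
    change (exp2 l) with (primrec F0 G 0 l). unfold primrec.
    set (c := minimize (history F0 G) (pair 0 l)) in *. rewrite psnd_pair in B.
    exists (pfst c), (psnd c).
    assert (K : forall i r, beta (pfst c) (psnd c) i r <-> r = bseq c i).
    { intros i r. rewrite beta_bseq. unfold bseq at 1. rewrite pfst_pair, psnd_pair. reflexivity. }
    split; [|split].
    + apply K. rewrite A. reflexivity.
    + intros i Hi. exists (bseq c i). split; apply K; auto.
      rewrite B by auto. unfold G. rewrite psnd_pair. reflexivity.
    + apply K. reflexivity.
Qed.

Definition slen (s : num) : num := minimize (fun s l => s + 1 < exp2 l + exp2 l) s.
Lemma slen_ex (s : num) : exists l, s + 1 < exp2 l + exp2 l.
Proof. exists s. lin (lt_exp2 s) (lt_exp2 s) (le0 s). Qed.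
Let fun_slen : is_fun slen.
Proof. apply fun_minimize; [definable|apply slen_ex]. Qed.
Lemma slen_hi s : s + 1 < exp2 (slen s) + exp2 (slen s).
Proof. apply (minimize_spec (fun s l => s + 1 < exp2 l + exp2 l)); [definable|apply slen_ex]. Qed.
Lemma slen_lo s : exp2 (slen s) <= s + 1.
Proof.
  destruct (minimize_spec (fun s l => s + 1 < exp2 l + exp2 l)) with (n := s) as [_ H]; [definable|apply slen_ex|].
  fold (slen s) in H. destruct (zero_or_succ (slen s)) as [E|[l E]].
  - rewrite E, exp2_0. lin (le0 s).
  - rewrite E, exp2_S. destruct (le_or_lt (exp2 l + exp2 l) (s + 1)) as [|L]; auto.
    elim (H l); auto. rewrite E; lin.
Qed.
Lemma slen_uniq s l : exp2 l <= s + 1 -> s + 1 < exp2 l + exp2 l -> l = slen s.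
Proof.
  intros H K. apply le_antisym.
  - destruct (le_or_lt l (slen s)) as [|L]; auto. apply exp2_lt in L. lin L H (slen_hi s).
  - destruct (le_or_lt (slen s) l) as [|L]; auto. apply exp2_lt in L. lin L K (slen_lo s).
Qed.
Lemma len_slen s l : len s l <-> slen s = l.
Proof.
  split.
  - intros [p [H [H1 H2]]]. apply pow2_iff in H; subst p. symmetry; apply slen_uniq; auto.
  - intros <-. exists (exp2 (slen s)). repeat split; [apply pow2_iff; auto|apply slen_lo|apply slen_hi].
Qed.
Lemma slen_le s : slen s <= s.
Proof. lin (lt_exp2 (slen s)) (slen_lo s). Qed.

Definition snoc (t b : num) : num := t + t + 1 + b.
Lemma snoc1_eq (t : num) : snoc1 t = snoc t 1. Proof. reflexivity. Qed.

Lemma parity (n : num) : exists m b, b <= 1 /\ n = m + m + b.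
Proof.
  enough (K : exists w, psnd w <= 1 /\ n = pfst w + pfst w + psnd w).
  { destruct K as [w K]; eauto. }
  revert n. apply (sig_ind (fun n w => psnd w <= 1 /\ n = pfst w + pfst w + psnd w)); [definable| |].
  - exists (pair 0 0). rewrite pfst_pair, psnd_pair. split; [lin|ring].
  - intros n [w [Hb ->]]. set (m := pfst w) in *. destruct Hb as [Hb|Hb].
    + exists (pair m 1). rewrite pfst_pair, psnd_pair. split; [lin|].
      assert (psnd w = 0) as -> by (apply le_antisym; [lin Hb|apply le0]). ring.
    + exists (pair (m + 1) 0). rewrite pfst_pair, psnd_pair, Hb. split; [lin|ring].
Qed.
Lemma double_inj (x y b c : num) : b <= 1 -> c <= 1 -> x + x + b = y + y + c -> x = y /\ b = c.
Proof.
  intros Hb Hc H. destruct (div_uniq (1 + 1) x b y c) as [E E']; auto.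
  - lin Hb.
  - lin Hc.
  - replace (x * (1 + 1) + b) with (x + x + b) by ring. rewrite H. ring.
Qed.
Lemma str_cases s : s = 0 \/ exists t b, b <= 1 /\ s = snoc t b /\ t < s.
Proof.
  destruct (zero_or_succ s) as [|[n ->]]; auto. right.
  destruct (parity n) as [m [b [Hb ->]]]. exists m, b. unfold snoc. repeat split; auto; [ring|].
  lin (le0 m) (le0 b).
Qed.
Lemma str_ind P : is_set P -> P 0 -> (forall t b, b <= 1 -> P t -> P (snoc t b)) -> forall s, P s.
Proof.
  intros HP H0 HS. apply strong_ind; auto.
  intros n IH. destruct (str_cases n) as [->|[t [b [Hb [E L]]]]]; auto.
  rewrite E. auto.
Qed.

Lemma slen_0 : slen 0 = 0.
Proof. symmetry; apply slen_uniq; rewrite exp2_0; lin. Qed.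
Lemma slen_snoc t b : b <= 1 -> slen (snoc t b) = slen t + 1.
Proof.
  intro Hb. symmetry; apply slen_uniq; rewrite exp2_S; unfold snoc.
  - lin (slen_lo t) (slen_lo t) (le0 b).
  - lin (slen_hi t) (slen_hi t) Hb.
Qed.
Lemma slen_eq0 s : slen s = 0 -> s = 0.
Proof.
  destruct (str_cases s) as [|[t [b [Hb [-> _]]]]]; auto.
  rewrite slen_snoc by auto. intro H. elim (ax_succ_neq0 ax H).
Qed.

(** * Initial segments and bits *)

Lemma prefix_iff0 s t : prefix s t <-> exists k r, r < exp2 k /\ t + 1 = (s + 1) * exp2 k + r.
Proof.
  split.
  - intros [k [p [r [Hp H]]]]. apply pow2_iff in Hp; subst; eauto.
  - intros [k [r H]]. exists k, (exp2 k), r. split; auto. apply pow2_iff; auto.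
Qed.
Lemma prefix_refl s : prefix s s.
Proof. apply prefix_iff0. exists 0, 0. rewrite exp2_0. split; [lin|ring]. Qed.
(** Comparing parities in t + 1 = (s + 1) * 2^k + r shows that dropping the last bit
    of t halves both 2^k and r. *)
Lemma prefix_snoc s t b : b <= 1 -> prefix s (snoc t b) <-> s = snoc t b \/ prefix s t.
Proof.
  intro Hb. rewrite !prefix_iff0. split.
  - intros [k [r [Hr H]]]. destruct (zero_or_succ k) as [->|[l ->]].
    + left. rewrite exp2_0 in *. assert (r = 0) as -> by (apply le_antisym; [lin Hr|apply le0]).
      apply (add_cancel _ _ 1). rewrite H. ring.
    + right. rewrite exp2_S in *. destruct (parity r) as [m [c [Hc ->]]].
      exists l, m. unfold snoc in H.
      destruct (double_inj (t + 1) ((s + 1) * exp2 l + m) b c) as [E ->]; auto.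
      * transitivity (t + t + 1 + b + 1); [ring|]. rewrite H. ring.
      * split; [|auto]. destruct (lt_or_le m (exp2 l)) as [|L]; auto. lin Hr L L (le0 c).
  - intros [->|[k [r [Hr H]]]].
    + exists 0, 0. rewrite exp2_0. split; [lin|ring].
    + exists (k + 1), (r + r + b). rewrite exp2_S. split; [lin Hr Hr Hb|].
      unfold snoc. transitivity ((t + 1) + (t + 1) + b); [ring|]. rewrite H. ring.
Qed.
Lemma prefix_0 s : prefix s 0 <-> s = 0.
Proof.
  split; [|intros ->; apply prefix_refl].
  rewrite prefix_iff0. intros [k [r [Hr H]]].
  assert (K : 1 <= exp2 k) by lin (exp2_pos k).
  pose proof (le_mul _ _ _ _ (le_refl (s + 1)) K).
  apply le_antisym; [|apply le0]. lin H0 (eq_sym H) (le0 r).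
Qed.

Let set_prefix : is_set (fun w => prefix (pfst w) (psnd w)).
Proof.
  apply (set_ext (fun w => exists k, k < psnd w + 1 /\ exists r, r < psnd w + (1 + 1) /\
    r < exp2 k /\ psnd w + 1 = (pfst w + 1) * exp2 k + r)); [definable|].
  intro w. generalize (pfst w) (psnd w). intros s t. rewrite prefix_iff0. split.
  - intros [k [_ [r [_ H]]]]; eauto.
  - intros [k [r [Hr H]]]. exists k. split.
    + assert (K : 1 <= s + 1) by lin (le0 s).
      pose proof (le_mul _ _ _ _ K (le_refl (exp2 k))).
      lin H0 (eq_sym H) (le0 r) (lt_exp2 k).
    + exists r. repeat split; auto. lin (eq_sym H) (le0 ((s + 1) * exp2 k)).
Qed.
Lemma prefix_le s t : prefix s t -> s <= t.
Proof.
  rewrite prefix_iff0. intros [k [r [Hr H]]].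
  assert (K : 1 <= exp2 k) by lin (exp2_pos k).
  pose proof (le_mul _ _ _ _ (le_refl (s + 1)) K). lin H0 (eq_sym H) (le0 r).
Qed.
Let set_bit1 : is_set (fun w => bit1 (pfst w) (psnd w)).
Proof.
  apply (set_ext (fun w => exists t, t < pfst w + 1 /\ slen t = psnd w /\
    prefix (t + t + 1 + 1) (pfst w))); [definable|].
  intro w. unfold bit1. split.
  - intros [t [_ [Ht K]]]. exists t. rewrite len_slen. auto.
  - intros [t [Ht K]]. apply len_slen in Ht. exists t. split; auto.
    apply prefix_le in K. unfold snoc1 in K. lin K (le0 t).
Qed.
Let fun_snoc : is_fun (fun w => snoc (pfst w) (psnd w)).
Proof. unfold snoc. definable. Qed.

Lemma bit1_0 i : ~ bit1 (M := M) 0 i.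
Proof.
  intros [t [_ H]]. apply prefix_0 in H. unfold snoc1 in H. elim (ax_succ_neq0 ax H).
Qed.
Lemma bit1_snoc t b i : b <= 1 -> bit1 (snoc t b) i <-> bit1 t i \/ (i = slen t /\ b = 1).
Proof.
  intro Hb. unfold bit1. split.
  - intros [u [Hu H]]. apply prefix_snoc in H; auto. destruct H as [H|H]; [|eauto].
    rewrite snoc1_eq in H. unfold snoc in H. right.
    assert (E : u + u + 1 = t + t + b) by (apply (add_cancel _ _ 1); rewrite H; ring).
    apply double_inj in E; [|lin|auto]. destruct E as [-> <-]. apply len_slen in Hu. auto.
  - intros [[u [Hu H]]|[-> ->]].
    + exists u. split; auto. apply prefix_snoc; auto.
    + exists t. split; [apply len_slen; auto|]. apply prefix_refl.
Qed.
Lemma bit1_lt s i : bit1 s i -> i < slen s.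
Proof.
  revert s. induct str_ind; [definable|intro H; elim (bit1_0 _ H)|].
  intros t b Hb IH H. apply bit1_snoc in H; auto. rewrite slen_snoc by auto.
  destruct H as [H|[-> _]]; [|lin]. apply IH in H. lin H.
Qed.
Lemma prefix_slen s t : prefix s t -> s = t \/ slen s < slen t.
Proof.
  revert t. induct str_ind; [definable|intro H; apply prefix_0 in H; auto|].
  intros t b Hb IH H. apply prefix_snoc in H; auto. destruct H as [H|H]; auto.
  right. rewrite slen_snoc by auto. destruct (IH H) as [->|K]; [lin|lin K].
Qed.
Lemma prefix_bits s t : prefix s t -> slen s <= slen t /\ forall i, i < slen s -> bit1 s i <-> bit1 t i.
Proof.
  revert t. induct str_ind; [definable| |].
  - intro H. apply prefix_0 in H. subst. split; [apply le_refl|tauto].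
  - intros t b Hb IH H. apply prefix_snoc in H; auto. destruct H as [->|H].
    + split; [apply le_refl|tauto].
    + destruct (IH H) as [L K]. rewrite slen_snoc by auto. split; [lin L|].
      intros i Hi. rewrite K, bit1_snoc by auto. split; auto. intros [|[-> _]]; auto.
      lin L Hi.
Qed.
(** Induction on t for all s simultaneously.  As a quantifier over all s would
    not define a set, it is bounded by the codes of strings no longer than t. *)
Lemma bits_prefix s t : slen s <= slen t -> (forall i, i < slen s -> bit1 s i <-> bit1 t i) -> prefix s t.
Proof.
  revert s.
  enough (K : forall s, s < t + t + (1 + 1) -> slen s <= slen t ->
    (forall i, i < slen s -> bit1 s i <-> bit1 t i) -> prefix s t).
  { intros s H. apply K; auto. destruct H as [H|H].
    - apply exp2_lt in H. lin H (slen_hi s) (slen_lo t) (le0 t).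
    - pose proof (slen_hi s) as A. rewrite H in A. lin A (slen_lo t) (slen_lo t). }
  revert t. apply (str_ind (fun t => forall s, s < t + t + (1 + 1) -> slen s <= slen t ->
    (forall i, i < slen s -> bit1 s i <-> bit1 t i) -> prefix s t)); [definable| |].
  - intros s _ H _. rewrite slen_0 in H. assert (slen s = 0) as K by (apply le_antisym; auto using le0).
    apply slen_eq0 in K. subst. apply prefix_refl.
  - intros t b Hb IH s Hs Hl H. apply prefix_snoc; auto. rewrite slen_snoc in Hl by auto.
    assert (Hbd : forall u, slen u <= slen t -> u < t + t + (1 + 1)).
    { intros u [L|L].
      - apply exp2_lt in L. lin L (slen_hi u) (slen_lo t) (le0 t).
      - pose proof (slen_hi u) as A. rewrite L in A. lin A (slen_lo t) (slen_lo t). }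
    destruct Hl as [L|L].
    + right. apply IH; [apply Hbd; lin L|lin L|].
      intros i Hi. rewrite H, bit1_snoc by auto. split; auto. intros [|[-> _]]; auto.
      lin L Hi.
    + left. destruct (str_cases s) as [->|[u [c [Hc [-> _]]]]].
      { rewrite slen_0 in L. elim (ax_succ_neq0 ax (eq_sym L)). }
      rewrite slen_snoc in L by auto. apply add_cancel in L.
      assert (Hp : prefix u t).
      { apply IH; [apply Hbd; rewrite L; apply le_refl|rewrite L; apply le_refl|].
        intros i Hi. specialize (H i). rewrite slen_snoc, !bit1_snoc in H by auto.
        assert (i <> slen t) by (intros ->; lin Hi L).
        rewrite <- L in H0. assert (Hi' : i < slen u + 1) by lin Hi. specialize (H Hi').
        rewrite L in *. tauto. }
      apply prefix_slen in Hp. destruct Hp as [->|Hp]; [|rewrite L in Hp; elim (lt_irrefl _ Hp)].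
      f_equal. specialize (H (slen t)). rewrite slen_snoc, !bit1_snoc in H by auto.
      assert (L1 : slen t < slen t + 1) by lin. specialize (H L1).
      assert (N : ~ bit1 t (slen t)) by (intro N; apply bit1_lt in N; elim (lt_irrefl _ N)).
      assert (B : forall d : num, d <= 1 -> d <> 1 -> d = 0).
      { intros d [Hd|Hd] Hn; [|tauto]. apply le_antisym; [lin Hd|apply le0]. }
      destruct (classic (b = 1)) as [E|E], (classic (c = 1)) as [E'|E']; try tauto; try congruence.
      rewrite (B b), (B c); auto.
Qed.
Lemma prefix_iff s t :
  prefix s t <-> slen s <= slen t /\ forall i, i < slen s -> bit1 s i <-> bit1 t i.
Proof. split; [apply prefix_bits|intros [H K]; apply bits_prefix; auto]. Qed.
Lemma str_eq s t : slen s = slen t -> (forall i, i < slen s -> bit1 s i <-> bit1 t i) -> s = t.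
Proof.
  intros H K. destruct (prefix_slen s t) as [|L]; auto.
  - apply bits_prefix; auto.
  - rewrite H in L. elim (lt_irrefl _ L).
Qed.
(** Strings can be specified by their length and their bits. *)
Lemma str_ex P l : is_set P -> exists s, slen s = l /\ forall i, i < l -> bit1 s i <-> P i.
Proof.
  intro HP. revert l.
  apply (sig_ind (fun l s => slen s = l /\ forall i, i < l -> bit1 s i <-> P i)); [definable| |].
  - exists 0. split; [apply slen_0|]. intros i K; elim (ax_lt0 ax K).
  - intros l [s [<- H]].
    assert (K : forall i, i < slen s + 1 -> i = slen s \/ i <> slen s /\ i < slen s).
    { intros i Hi. apply lt_succ in Hi. destruct Hi; auto. right; split; auto. intros ->. eapply lt_irrefl; eauto. }
    assert (N : ~ bit1 s (slen s)) by (intro N; apply bit1_lt in N; elim (lt_irrefl _ N)).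
    destruct (classic (P (slen s))) as [Y|Y].
    + assert (Hb : (1 : num) <= 1) by apply le_refl.
      exists (snoc s 1). split; [apply slen_snoc; auto|]. intros i Hi. rewrite bit1_snoc by auto.
      destruct (K i Hi) as [->|[Hn Hi']]; [tauto|]. rewrite H; tauto.
    + assert (Hb : (0 : num) <= 1) by apply le0.
      exists (snoc s 0). split; [apply slen_snoc; auto|]. intros i Hi. rewrite bit1_snoc by auto.
      assert (E : (0 : num) <> 1) by (intro E; apply (ax_succ_neq0 ax (n := 0)); rewrite add0l; auto).
      destruct (K i Hi) as [->|[Hn Hi']]; [tauto|]. rewrite H; tauto.
Qed.

Lemma prefix_trans s t u : prefix s t -> prefix t u -> prefix s u.
Proof.
  rewrite !prefix_iff. intros [A B] [C D]. split; [lin A C|].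
  intros i Hi. rewrite B by auto. apply D. lin Hi A.
Qed.
Lemma restr_iff X n s : restr X n s <-> slen s = n /\ forall i, i < n -> (i in_ X <-> bit1 s i).
Proof. unfold restr. rewrite len_slen. tauto. Qed.
Lemma restr_ex X n : exists s, restr X n s.
Proof.
  destruct (str_ex (fun i => i in_ X) n) as [s [A B]]; [definable|].
  exists s. apply restr_iff. split; auto. intros; symmetry; auto.
Qed.
Lemma path_iff C X : path C X <-> forall n s, restr X n s -> s in_ C.
Proof.
  split.
  - intros H n s Hs. destruct (H n) as [t [Ht K]]. apply restr_iff in Hs, Ht.
    destruct Hs as [A B], Ht as [A' B'].
    rewrite (str_eq s t); auto; [congruence|]. intros i Hi. rewrite A in Hi.
    rewrite <- B, B' by auto. tauto.
  - intros H n. destruct (restr_ex X n) as [s Hs]. eauto.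
Qed.
Lemma path_strings E X l : path E X -> exists s, slen s = l /\ s in_ E /\ restr X l s.
Proof. intro H. destruct (H l) as [s [A B]]. exists s. split; auto. apply restr_iff in A. tauto. Qed.
Lemma path_bit C X l : path C X ->
  exists s, slen s = l /\ s in_ C /\ forall i, i < l -> i in_ X <-> bit1 s i.
Proof. intro H. destruct (H l) as [s [A B]]. apply restr_iff in A. exists s. tauto. Qed.
(** Codes of long strings are large, so unbounded lengths make the tree infinite. *)
Lemma wkl_path T : WKL M -> tree T -> (forall l, exists s, slen s = l /\ s in_ T) -> exists X, path T X.
Proof.
  intros HW HT H. apply HW; auto. intro n. destruct (H (n + 1)) as [s [A B]].
  exists s. split; auto. lin (eq_sym A) (slen_le s).
Qed.

(** * Arithmetical comprehension yields minimal subsystems *)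

(** The dual of closure under unbounded existential quantifiers, whatever the reason for the latter. *)
Lemma set_all :
  (forall P, is_set (fun w => P (pfst w) (psnd w)) -> is_set (fun n => exists x, P n x)) ->
  forall P, is_set (fun w => P (pfst w) (psnd w)) -> is_set (fun n => forall x, P n x).
Proof.
  intros Hex P HP. apply (set_ext (fun n => ~ exists x, ~ P n x)).
  - apply set_not, Hex, set_not, HP.
  - intro n; split.
    + intros H x. apply NNPP. intro K; apply H; eauto.
    + intros H [x K]; auto.
Qed.

Section Greedy.
Hypothesis HW : WKL M.
Hypothesis HA : ACA M.

Lemma set_ex P : is_set (fun w => P (pfst w) (psnd w)) -> is_set (fun n => exists x, P n x).
Proof.
  intros [X HX].
  set (pr := TAdd (TMul (TAdd (TVar 1) (TVar 0)) (TAdd (TVar 1) (TVar 0))) (TVar 1)).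
  destruct (HA (FEx (FMem pr 0%nat)) (fun _ => X) zeros) as [Y HY].
  exists Y. intro n. rewrite HY. cbn. unfold pair in HX.
  split; intros [x Hx]; exists x.
  - apply HX in Hx. fold (pair n x) in Hx. rewrite pfst_pair, psnd_pair in Hx. exact Hx.
  - apply HX. fold (pair n x). rewrite pfst_pair, psnd_pair. exact Hx.
Qed.
Ltac definable_quantifier ::= lazymatch goal with
  | |- is_set (fun w => exists x, _) => apply set_ex
  | |- is_set (fun w => forall x, _) => apply (set_all set_ex)
  end.

Variables C f : sets.
Hypothesis HS : is_system C f.
Let Hf := sys_map HS.

Definition fapp (s : num) : num := epsilon (inhabits 0) (fun t => maps f s t).
Lemma fapp_maps s : maps f s (fapp s).
Proof. unfold fapp. apply epsilon_spec. apply (ec_total Hf). Qed.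
Lemma fapp_eq s t : maps f s t <-> fapp s = t.
Proof.
  split; [intro H; apply (ec_functional Hf (fapp_maps s) H)|intros <-; apply fapp_maps].
Qed.
Let fun_fapp : is_fun fapp.
Proof. exists f. apply fapp_eq. Qed.
Lemma fapp_mono s t : prefix s t -> prefix (fapp s) (fapp t).
Proof. intro H. apply (ec_monotone Hf H); apply fapp_maps. Qed.
Lemma fapp_short s : s <> 0 -> slen (fapp s) < slen s.
Proof.
  intro H. destruct (ec_shorter Hf H) as [t [k [l [A [B [D L]]]]]].
  apply fapp_eq in A. apply len_slen in B, D. subst. exact L.
Qed.
(** The empty string has no image shorter than itself; its image is empty by
    monotonicity, being below the image of a string of length 1. *)
Lemma fapp_slen s : slen (fapp s) <= slen s.
Proof.
  destruct (classic (s = 0)) as [->|H]; [|left; apply fapp_short; auto].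
  assert (K : prefix 0 (snoc 0 1)) by (apply prefix_snoc; [apply le_refl|right; apply prefix_refl]).
  apply fapp_mono, prefix_iff in K. destruct K as [K _].
  assert (N : snoc 0 1 <> 0) by (unfold snoc; apply (ax_succ_neq0 ax)).
  apply fapp_short in N. rewrite slen_snoc in N by apply le_refl. lin K N.
Qed.

Definition iter (t n : num) : num := primrec (fun t => t) (fun w => fapp (psnd w)) t n.
Lemma iter_0 t : iter t 0 = t.
Proof. unfold iter. rewrite primrec_0; auto; definable. Qed.
Lemma iter_S t n : iter t (n + 1) = fapp (iter t n).
Proof. unfold iter. rewrite primrec_S; [|definable..]. rewrite psnd_pair; auto. Qed.
Let fun_iter : is_fun (fun w => iter (pfst w) (psnd w)).
Proof. apply fun_primrec; definable. Qed.
Lemma iter_fapp t n : iter (fapp t) n = iter t (n + 1).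
Proof.
  revert n. induct set_ind; [definable| |].
  - rewrite iter_S, !iter_0. reflexivity.
  - intros n IH. rewrite iter_S, IH, !iter_S. reflexivity.
Qed.
Lemma iter_mono s t n : prefix s t -> prefix (iter s n) (iter t n).
Proof.
  intro H. revert n. induct set_ind; [definable| |].
  - rewrite !iter_0. exact H.
  - intros n IH. rewrite !iter_S. apply fapp_mono, IH.
Qed.
Lemma iter_slen t n : slen (iter t n) <= slen t.
Proof.
  revert n. induct set_ind; [definable| |].
  - rewrite iter_0. apply le_refl.
  - intros n IH. rewrite iter_S. apply (le_trans _ (slen (iter t n))); auto. apply fapp_slen.
Qed.
Lemma iter_closed E t n : is_system E f -> t in_ E -> iter t n in_ E.
Proof.
  intros HE Ht. revert n. induct set_ind; [definable| |].
  - rewrite iter_0. exact Ht.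
  - intros n IH. rewrite iter_S. apply (sys_closed HE IH), fapp_maps.
Qed.

(** * The greedy subsystem *)

(** The orbit of t never extends a string satisfying P. *)
Definition avoids (P : num -> Prop) (t : num) :=
  t in_ C /\ forall n j, P j -> ~ prefix j (iter t n).
(** The finite set of strings coded by c is the set of positions of its bits 1. *)
Definition viable (c : num) := forall l, exists t, slen t = l /\ avoids (bit1 c) t.
(** The bit appended to c decides whether the string with code [slen c] is forbidden. *)
Definition step (c s : num) :=
  viable (snoc c 1) /\ s = snoc c 1 \/ ~ viable (snoc c 1) /\ s = snoc c 0.
Let set_viable : is_set viable.
Proof. unfold viable, avoids. definable. Qed.
Lemma set_step : is_set (fun w => step (pfst w) (psnd w)).
Proof. unfold step. definable. Qed.
Lemma step_ex c : exists s, step c s.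
Proof. unfold step. destruct (classic (viable (snoc c 1))); eauto. Qed.
Definition approx (i : num) : num := primrec (fun _ => 0) (fun w => minimize step (psnd w)) 0 i.
Definition chosen (i : num) := bit1 (approx (i + 1)) i.

Let fun_minimize_step : is_fun (minimize step).
Proof. apply fun_minimize; [apply set_step|apply step_ex]. Qed.
Let fun_approx : is_fun approx.
Proof.
  pose proof (fun_primrec (fun _ => 0) (fun w => minimize step (psnd w)) ltac:(definable) ltac:(definable)).
  unfold approx. definable.
Qed.
Lemma approx_0 : approx 0 = 0.
Proof. unfold approx. rewrite primrec_0; auto; definable. Qed.
Lemma approx_S i : step (approx i) (approx (i + 1)).
Proof.
  unfold approx at 2. rewrite primrec_S; [|definable..]. rewrite psnd_pair. fold (approx i).
  apply minimize_spec; [apply set_step|apply step_ex].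
Qed.
Lemma approx_snoc i : exists b, b <= 1 /\ approx (i + 1) = snoc (approx i) b /\
  (b = 1 <-> viable (snoc (approx i) 1)).
Proof.
  destruct (approx_S i) as [[H ->]|[H ->]].
  - exists 1. split; [apply le_refl|tauto].
  - exists 0. split; [apply le0|]. split; auto. split; [|tauto].
    intro E. elim (ax_succ_neq0 ax (n := 0)). rewrite add0l; auto.
Qed.
Lemma approx_slen i : slen (approx i) = i.
Proof.
  revert i. induct set_ind; [definable|rewrite approx_0; apply slen_0|].
  intros i IH. destruct (approx_snoc i) as [b [Hb [-> _]]]. rewrite slen_snoc, IH; auto.
Qed.
Lemma approx_chosen i j : j < i -> bit1 (approx i) j <-> chosen j.
Proof.
  unfold chosen. revert i. induct set_ind; [definable|intro K; elim (ax_lt0 ax K)|].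
  intros i IH H. apply lt_succ in H. destruct H as [H| ->]; [|tauto].
  rewrite <- IH by auto. destruct (approx_snoc i) as [b [Hb [-> _]]].
  rewrite bit1_snoc by auto. rewrite approx_slen. split; auto. intros [|[-> _]]; auto.
  elim (lt_irrefl _ H).
Qed.
Lemma chosen_iff i : chosen i <-> viable (snoc (approx i) 1).
Proof.
  unfold chosen. destruct (approx_snoc i) as [b [Hb [-> <-]]]. rewrite bit1_snoc by auto.
  rewrite approx_slen. split; auto. intros [H|]; [|tauto].
  apply bit1_lt in H. rewrite approx_slen in H. elim (lt_irrefl _ H).
Qed.
Lemma approx_viable i : viable (approx i).
Proof.
  revert i. induct set_ind; [definable| |].
  - rewrite approx_0. intro l. destruct (sys_nonempty HS) as [X HX].
    destruct (path_strings _ _ l HX) as [s [A [B _]]]. exists s. split; auto. split; auto.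
    intros n j K. elim (bit1_0 _ K).
  - intros i IH. destruct (approx_S i) as [[H ->]|[_ ->]]; auto.
    intro l. destruct (IH l) as [t [A [B D]]]. exists t. split; auto. split; auto.
    intros n j K. apply bit1_snoc in K; [|apply le0]. destruct K as [K|[_ K]]; auto.
    elim (ax_succ_neq0 ax (n := 0)). rewrite add0l; auto.
Qed.

Lemma avoids_tree P s t : prefix s t -> avoids P t -> avoids P s.
Proof.
  intros H [A B]. split; [apply (sys_tree HS H A)|].
  intros n j K L. apply (B n j K). apply (prefix_trans _ (iter s n)); auto. apply iter_mono, H.
Qed.
Lemma avoids_fapp P t : avoids P t -> avoids P (fapp t).
Proof.
  intros [A B]. split; [apply (sys_closed HS A), fapp_maps|].
  intros n j K. rewrite iter_fapp. auto.
Qed.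

(** Only strings of length at most l can be met by the orbit of a string of
    length l; their codes are below 2^(l+1), so the finite approximation at this
    stage already decides about all of them. *)
Lemma avoids_chosen_ex l : exists t, slen t = l /\ avoids chosen t.
Proof.
  destruct (approx_viable (exp2 l + exp2 l) l) as [t [A [B D]]]. exists t. split; auto. split; auto.
  intros n j K L. apply (D n j); auto. apply approx_chosen; auto.
  apply prefix_iff in L. destruct L as [L _].
  assert (L' : slen j <= l) by (rewrite <- A; apply (le_trans _ _ _ L), iter_slen).
  destruct L' as [L'|L'].
  - apply exp2_lt in L'. lin (slen_hi j) L' (exp2_pos l).
  - pose proof (slen_hi j) as J. rewrite L' in J. lin J.
Qed.

(** If X is a path of D and its initial segment s is missing from E, then the initial
    segments of any path of E avoid s in addition to all strings chosen before s.
    Hence s is chosen, and no string of D extends it. *)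
Theorem ACA_minimal : exists D, subsystem D C f /\ minimal_system D f.
Proof.
  assert (HZ : is_set (avoids chosen)) by (unfold avoids, chosen; definable).
  destruct HZ as [D HD].
  assert (HsD : is_system D f).
  { constructor.
    - intros s t H K. apply HD. apply HD in K. eapply avoids_tree; eauto.
    - exact Hf.
    - apply wkl_path; auto.
      + intros s t H K. apply HD. apply HD in K. eapply avoids_tree; eauto.
      + intro l. destruct (avoids_chosen_ex l) as [t [A B]]. exists t. rewrite HD. auto.
    - intros s t K H. apply HD. apply HD in K. apply fapp_eq in H. subst. apply avoids_fapp, K. }
  exists D. split.
  - split; auto. intros X HX n. destruct (HX n) as [s [A B]]. exists s. split; auto.
    apply HD in B. apply B.
  - split; auto. intros E HE HED X. split; [apply HED|]. intro HX.
    apply path_iff. intros n s Hs. apply NNPP. intro Hns.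
    assert (Zs : chosen s).
    { apply chosen_iff. intro l. destruct (sys_nonempty HE) as [Y HY].
      destruct (path_strings _ _ l HY) as [t [A [B B']]]. exists t. split; auto.
      assert (HtD : avoids chosen t).
      { apply HD. apply HED in HY. rewrite path_iff in HY. apply (HY l), B'. }
      destruct HtD as [HtC Ht]. split; auto. intros m j K L.
      apply bit1_snoc in K; [|apply le_refl]. rewrite approx_slen in K. destruct K as [K|[-> _]].
      - apply (Ht m j); auto. apply (approx_chosen s); auto.
        apply bit1_lt in K. rewrite approx_slen in K. exact K.
      - apply Hns. apply (sys_tree HE L). apply iter_closed; auto. }
    rewrite path_iff in HX. apply HX in Hs. apply HD in Hs. destruct Hs as [_ Hs].
    apply (Hs 0 s Zs). rewrite iter_0. apply prefix_refl.
Qed.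
End Greedy.

(** * Minimal subsystems yield arithmetical comprehension *)

(** Delta01 comprehension for a predicate whose complement has its own Sigma01 definition. *)
Lemma set_delta P A B : is_set (fun w => A (pfst w) (psnd w)) -> is_set (fun w => B (pfst w) (psnd w)) ->
  (forall n, P n <-> exists x, A n x) -> (forall n, ~ P n <-> exists x, B n x) -> is_set P.
Proof.
  intros [X HX] [Y HY] KA KB. pose (V := env2 X Y).
  apply (set_intro _ V (fun _ x n => pair n x in_ V 0%nat) (fun _ x n => ~ pair n x in_ V 1%nat) 0);
    [intros; bounded_tac..| |]; intro n; cbn.
  - rewrite KA. split; intros [x Hx]; exists x.
    + apply HX. rewrite pfst_pair, psnd_pair. exact Hx.
    + apply HX in Hx. rewrite pfst_pair, psnd_pair in Hx. exact Hx.
  - split.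
    + intros H x K. apply HY in K. rewrite pfst_pair, psnd_pair in K.
      assert (~ P n) by (apply KB; eauto). tauto.
    + intros H. apply NNPP. intro K. apply KB in K. destruct K as [x Hx]. apply (H x).
      apply HY. rewrite pfst_pair, psnd_pair. exact Hx.
Qed.

Lemma pair_mono (n i j : num) : i <= j -> pair n i <= pair n j.
Proof.
  intro H. assert (K : n + i <= n + j) by lin H. pose proof (le_mul _ _ _ _ K K) as L.
  unfold pair. lin L.
Qed.

(** Bit p of a shifted sequence is bit [next_pos p] of the sequence; the position
    (n, i) in the table is the number [pair n i]. *)
Definition next_pos (p : num) : num := pair (pfst p) (psnd p + 1).
Lemma next_pos_pair n i : next_pos (pair n i) = pair n (i + 1).
Proof. unfold next_pos. rewrite pfst_pair, psnd_pair. reflexivity. Qed.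
Lemma next_pos_le p : next_pos p <= p + p + p + 1.
Proof.
  destruct (unpair_spec p) as [H|[_ [H K]]].
  - unfold next_pos. set (i := pfst p) in *. set (j := psnd p) in *. rewrite H. unfold pair.
    lin (le_square (i + j)) (le_square (i + j)) (le0 (i + i)).
  - unfold next_pos. rewrite H, K. unfold pair. lin (le0 p) (le0 p) (le0 p).
Qed.
(** Since [next_pos p <= 3 * p + 1], the first l / 3 bits of the shifted sequence are
    determined by l bits of the sequence; [third] is division by 3. *)
Definition third (L : num) : num := minimize (fun L h => L < h + h + h + 1 + 1 + 1) L.
Lemma third_ex (L : num) : exists h : num, L < h + h + h + 1 + 1 + 1.
Proof. exists L. lin (le0 (L + L + 1 + 1)). Qed.
Let fun_third : is_fun third.
Proof. apply fun_minimize; [definable|apply third_ex]. Qed.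
Lemma third_hi L : L < third L + third L + third L + 1 + 1 + 1.
Proof. apply (minimize_spec (fun L h => L < h + h + h + 1 + 1 + 1)); [definable|apply third_ex]. Qed.
Lemma third_lo L : third L + third L + third L <= L.
Proof.
  destruct (minimize_spec (fun L h => L < h + h + h + 1 + 1 + 1)) with (n := L) as [_ H]; [definable|apply third_ex|].
  fold (third L) in H. destruct (zero_or_succ (third L)) as [E|[h E]].
  - rewrite E, !add0. apply le0.
  - destruct (le_or_lt (third L + third L + third L) L) as [|K]; auto.
    exfalso. rewrite E in K, H. apply (H h); [lin|lin K].
Qed.
Lemma third_le (a b : num) : a + a + a < b + b + b + 1 + 1 + 1 -> a <= b.
Proof.
  intro H. destruct (le_or_lt a b) as [|L]; auto. lin H L L L.
Qed.
Lemma third_mono L L' : L <= L' -> third L <= third L'.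
Proof. intro H. apply third_le. lin H (third_lo L) (third_hi L'). Qed.
Lemma third_triple l : third (l + l + l) = l.
Proof.
  apply le_antisym; apply third_le; [lin (third_lo (l + l + l))|lin (third_hi (l + l + l))].
Qed.

Definition shift_rel (s t : num) :=
  slen t = third (slen s) /\ forall p, p < third (slen s) -> bit1 t p <-> bit1 s (next_pos p).
Definition shift_str (s : num) : num := minimize shift_rel s.
Lemma set_shift_rel : is_set (fun w => shift_rel (pfst w) (psnd w)).
Proof. unfold shift_rel, next_pos. definable. Qed.
Lemma shift_rel_ex s : exists t, shift_rel s t.
Proof. apply str_ex. unfold next_pos. definable. Qed.
Lemma shift_str_spec s : shift_rel s (shift_str s).
Proof. exact (proj1 (minimize_spec _ set_shift_rel s (shift_rel_ex s))). Qed.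
Let fun_shift_str : is_fun shift_str.
Proof. apply fun_minimize; [apply set_shift_rel|apply shift_rel_ex]. Qed.
Lemma shift_str_slen s : slen (shift_str s) = third (slen s).
Proof. apply shift_str_spec. Qed.
Lemma shift_str_bit s p : bit1 (shift_str s) p <-> p < slen (shift_str s) /\ bit1 s (next_pos p).
Proof.
  destruct (shift_str_spec s) as [A B]. split.
  - intro H. pose proof (bit1_lt _ _ H) as L. split; auto. rewrite A in L. apply B; auto.
  - intros [L H]. apply B; auto. rewrite <- A. exact L.
Qed.
Lemma next_pos_lt s p : p < third (slen s) -> next_pos p < slen s.
Proof.
  intro H. pose proof (next_pos_le p) as K.
  pose proof (third_lo (slen s)). apply lt_le in H.
  pose proof (le_add _ _ _ _ (le_add _ _ _ _ H H) H). lin K H0 H1.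
Qed.
Lemma shift_str_mono s t : prefix s t -> prefix (shift_str s) (shift_str t).
Proof.
  rewrite !prefix_iff. intros [A B].
  assert (L : slen (shift_str s) <= slen (shift_str t)) by (rewrite !shift_str_slen; apply third_mono, A).
  split; auto. intros p Hp. rewrite !shift_str_bit.
  assert (Hn : next_pos p < slen s) by (apply next_pos_lt; rewrite <- shift_str_slen; exact Hp).
  rewrite B by auto. assert (p < slen (shift_str t)) by (eapply lt_le_trans; eauto). tauto.
Qed.

Lemma shift_map : exists f, encodes_continuous f /\ forall s t, maps f s t <-> shift_str s = t.
Proof.
  assert (K : is_set (fun w => w = pair (pfst w) (psnd w) /\ shift_str (pfst w) = psnd w)) by definable.
  destruct K as [f Hf]. exists f.
  assert (E : forall s t, maps f s t <-> shift_str s = t).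
  { intros s t. unfold maps. rewrite Hf, pfst_pair, psnd_pair. tauto. }
  split; auto. constructor.
  - intros n Hn. apply Hf in Hn. destruct Hn as [Hn _]; eauto.
  - intros s t t' A B. apply E in A, B. congruence.
  - intro s. exists (shift_str s). apply E; auto.
  - intros s t s' t' P A B. apply E in A, B. subst. apply shift_str_mono, P.
  - intro l. exists (l + l + l). intros s Hs. apply len_slen in Hs.
    exists (shift_str s), (slen (shift_str s)). split; [apply E; auto|]. split; [apply len_slen; auto|].
    rewrite shift_str_slen, Hs, third_triple. apply le_refl.
  - intros s Hs. exists (shift_str s), (slen (shift_str s)), (slen s).
    split; [apply E; auto|]. split; [apply len_slen; auto|]. split; [apply len_slen; auto|].
    rewrite shift_str_slen. pose proof (third_lo (slen s)) as L.
    destruct (zero_or_succ (third (slen s))) as [E0|[y E0]]; rewrite E0 in *.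
    + destruct (le0 (slen s)) as [|N]; auto. elim Hs. apply slen_eq0; auto.
    + lin L (le0 y) (le0 y).
Qed.

Section Coding.
Hypothesis HW : WKL M.
Hypothesis HP : minimal_subsystem_principle M.
Variable R : num -> num -> Prop.
Hypothesis HRr : is_set (fun w => R (pfst w) (psnd w)).

(** For a fixed d this is a bounded search, and it holds for large d iff n belongs to
    the set that is to be coded. *)
Definition entered (n d : num) := exists t, t < d /\ R n t.
Let set_entered : is_set (fun w => entered (pfst w) (psnd w)).
Proof. unfold entered. definable. Qed.
Lemma entered_le n d d' : entered n d -> d <= d' -> entered n d'.
Proof. intros [t [A B]] H. exists t. split; auto. eapply lt_le_trans; eauto. Qed.

(** Two entries 1 of column n have a distance that proves that n is in the coded
    set; outside of it there is at most one entry 1. *)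
Definition sparse (s : num) := forall n i d,
  bit1 s (pair n i) -> bit1 s (pair n (i + d + 1)) -> entered n (d + 1).
(** Once n has entered by stage d, every block of d places in column n has
    an entry 1.  As soon as the place just after the block lies inside the string,
    so does the whole block. *)
Definition dense (s : num) := forall n i d,
  entered n d -> pair n (i + d) < slen s -> exists j, j < d /\ bit1 s (pair n (i + j)).

Lemma set_code : is_set (fun s => sparse s /\ dense s).
Proof.
  apply (set_ext (fun s =>
    (forall n, n < slen s -> forall i, i < slen s -> forall d, d < slen s ->
       bit1 s (pair n i) -> bit1 s (pair n (i + d + 1)) -> entered n (d + 1)) /\
    (forall n, n < slen s -> forall i, i < slen s -> forall d, d < slen s + 1 ->
       entered n d -> pair n (i + d) < slen s ->
       exists j, j < d /\ bit1 s (pair n (i + j))))).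
  - definable.
  - intro s; split; intros [A B]; split.
    + intros n i d H K. pose proof (bit1_lt _ _ H) as L. pose proof (bit1_lt _ _ K) as L'.
      apply (A n) with i; auto.
      * lin L (pair_fst_le n i).
      * lin L (pair_snd_le n i).
      * lin L' (pair_snd_le n (i + d + 1)) (le0 i).
    + intros n i d H L. apply (B n) with (d := d); auto.
      * lin L (pair_fst_le n (i + d)).
      * lin L (pair_snd_le n (i + d)) (le0 d).
      * lin L (pair_snd_le n (i + d)) (le0 i).
    + intros n _ i _ d _ H K. apply (A n i d); auto.
    + intros n _ i _ d _ H K. apply (B n i d); auto.
Qed.

Lemma sparse_shift s : sparse s -> sparse (shift_str s).
Proof.
  intros H n i d A B. apply shift_str_bit in A, B. rewrite !next_pos_pair in *.
  apply (H n (i + 1)); [tauto|]. replace (i + 1 + d + 1) with (i + d + 1 + 1) by ring. tauto.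
Qed.
Lemma dense_shift s : dense s -> dense (shift_str s).
Proof.
  intros H n i d E L. pose proof L as L'. rewrite shift_str_slen in L'. apply next_pos_lt in L'.
  rewrite next_pos_pair in L'. replace (i + d + 1) with (i + 1 + d) in L' by ring.
  destruct (H n (i + 1) d E L') as [j [Hj B]]. exists j. split; auto.
  apply shift_str_bit. rewrite next_pos_pair. split.
  - eapply le_lt_trans; [|exact L]. apply pair_mono. lin Hj.
  - replace (i + j + 1) with (i + 1 + j) by ring. exact B.
Qed.
Lemma sparse_prefix s t : prefix s t -> sparse t -> sparse s.
Proof.
  rewrite prefix_iff. intros [A B] H n i d K L.
  apply (H n i d); apply B; auto; apply bit1_lt; auto.
Qed.
Lemma dense_prefix s t : prefix s t -> dense t -> dense s.
Proof.
  rewrite prefix_iff. intros [A B] H n i d E L.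
  destruct (H n i d E) as [j [Hj K]]; [eapply lt_le_trans; eauto|].
  exists j. split; auto. apply B; auto.
  eapply le_lt_trans; [|exact L]. apply pair_mono. lin Hj.
Qed.

(** If n enters first at stage e <= l, column n has its entries 1 at the multiples
    of e; the other columns vanish.  Stages beyond l do not concern a
    string of length l. *)
Lemma code_str_ex l : exists s, slen s = l /\ sparse s /\ dense s.
Proof.
  pose (is_first := fun n e => entered n e /\ forall e', e' < e -> ~ entered n e').
  destruct (str_ex (fun p => exists e, e < l + 1 /\
    (entered (pfst p) e /\ forall e', e' < e -> ~ entered (pfst p) e') /\
    exists q, q < psnd p + 1 /\ psnd p = q * e) l) as [s [A B]]; [definable|].
  exists s. split; auto.
  assert (K : forall n i, bit1 s (pair n i) <-> pair n i < l /\
     exists e, e <= l /\ is_first n e /\ exists q, i = q * e).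
  { intros n i. split.
    - intro H. pose proof (bit1_lt _ _ H) as L. rewrite A in L. split; auto.
      apply B in H; auto. rewrite pfst_pair, psnd_pair in H.
      destruct H as [e [He [F [q [_ Q]]]]]. exists e. split; [apply lt_succ, He|eauto].
    - intros [L [e [He [F [q Q]]]]]. apply B; auto. rewrite pfst_pair, psnd_pair.
      exists e. split; [apply lt_succ, He|]. split; auto. exists q. split; auto.
      destruct F as [[t [Ht _]] _]. assert (O : 1 <= e) by lin Ht (le0 t).
      pose proof (le_mul _ _ _ _ (le_refl q) O) as O'. lin O' (eq_sym Q). }
  split.
  - intros n i d H H'. apply K in H, H'. destruct H as [_ [e [_ [F [q Q]]]]].
    destruct H' as [_ [e' [_ [F' [q' Q']]]]].
    assert (e' = e) as -> by (apply (least_uniq (entered n)); auto).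
    apply (entered_le n e); [apply F|]. destruct (le_or_lt q' q) as [L|L].
    + pose proof (le_mul _ _ _ _ L (le_refl e)) as O. lin O Q' (eq_sym Q) (le0 d).
    + apply lt_le in L. pose proof (le_mul _ _ _ _ L (le_refl e)) as O. lin O (eq_sym Q') Q.
  - intros n i d E L. rewrite A in L.
    destruct (least (entered n) d) as [e F]; [definable|auto|].
    assert (He : e <= d).
    { destruct (le_or_lt e d) as [|G]; auto. elim (proj2 F d); auto. }
    assert (Hd : e <= l) by lin He L (pair_snd_le n (i + d)) (le0 i).
    assert (O : 0 < e) by (destruct F as [[t [Ht _]] _]; lin Ht (le0 t)).
    assert (Hj : exists j, j < d /\ exists q, i + j = q * e).
    { destruct (rem_eq i e) as [q Q]. pose proof (rem_lt i e O) as Hr.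
      destruct (zero_or_succ (rem i e)) as [Z0|[r Hr0]].
      - exists 0. split; [lin O He|]. exists q. rewrite Q, Z0. ring.
      - apply lt_ex in Hr. destruct Hr as [x Hx]. exists (x + 1). split.
        + lin He (eq_sym Hx) (eq_sym Hr0) (le0 r).
        + exists (q + 1). rewrite Q. transitivity (q * e + (rem i e + x + 1)); [ring|].
          rewrite <- Hx. ring. }
    destruct Hj as [j [Hj [q Q]]]. exists j. split; auto. apply K. split.
    + eapply le_lt_trans; [|exact L]. apply pair_mono. lin Hj.
    + exists e. split; auto. split; auto. eauto.
Qed.

Lemma code_system : exists C f, is_system C f /\ (forall s, s in_ C <-> sparse s /\ dense s) /\
  forall s t, maps f s t <-> shift_str s = t.
Proof.
  destruct set_code as [C HC]. destruct shift_map as [f [Hf E]].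
  exists C, f. split; [|auto].
  assert (T : tree C).
  { intros s t H K. apply HC. apply HC in K. destruct K. split.
    - eapply sparse_prefix; eauto.
    - eapply dense_prefix; eauto. }
  constructor; auto.
  - apply wkl_path; auto. intro l. destruct (code_str_ex l) as [s [A B]]. exists s. rewrite HC. auto.
  - intros s t K H. apply E in H. subst. apply HC. apply HC in K. destruct K; split.
    + apply sparse_shift; auto.
    + apply dense_shift; auto.
Qed.

(** * Reading off the coded set from a minimal subsystem *)

Section Minimal.
Variables C D f : sets.
Hypothesis HC : forall s, s in_ C <-> sparse s /\ dense s.
Hypothesis Hf : forall s t, maps f s t <-> shift_str s = t.
Hypothesis HDC : paths_sub D C.
Hypothesis HD : minimal_system D f.

Lemma D_shift_str s : s in_ D -> shift_str s in_ D.
Proof. intro H. apply (sys_closed (proj1 HD) H). apply Hf; auto. Qed.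

(** All paths of D are 0 at (n, j), as witnessed by the strings of length l.  Without
    the first conjunct a small l would be a witness for trivial reasons. *)
Definition vanish (n j l : num) := pair n j < l /\
  forall s, s < exp2 l + exp2 l -> slen s = l -> s in_ D -> ~ bit1 s (pair n j).
Lemma str_bound s l : slen s = l -> s < exp2 l + exp2 l.
Proof. intros <-. lin (slen_hi s). Qed.

(** If (n, j) vanishes on D at length l, then (n, j + 1) does so at length 3 l, because
    images of strings of D lie in D.  The existential quantifier over l is
    the only unbounded one, which is what Sigma01 induction admits. *)
Lemma vanish_all n l : vanish n 0 l -> forall j, exists l, vanish n j l.
Proof.
  intro H0. apply (sig_ind (vanish n)); [unfold vanish; definable|eauto|].
  intros j [k [Hk H]]. exists (k + k + k).
  assert (L : pair n (j + 1) < k + k + k).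
  { pose proof (next_pos_le (pair n j)) as N. rewrite next_pos_pair in N. lin N Hk Hk Hk. }
  split; auto. intros s _ Hs HsD B.
  assert (E : slen (shift_str s) = k) by (rewrite shift_str_slen, Hs; apply third_triple).
  apply (H (shift_str s)); auto using D_shift_str, str_bound.
  apply shift_str_bit. rewrite E, next_pos_pair. auto.
Qed.

(** Otherwise all of column n vanishes on a path of D, contradicting [dense]. *)
Lemma not_vanish n t l : R n t -> ~ vanish n 0 l.
Proof.
  intros Ht H. pose proof (vanish_all n l H) as A.
  destruct (sys_nonempty (proj1 HD)) as [X HX].
  assert (NX : forall j, ~ pair n j in_ X).
  { intros j K. destruct (A j) as [k [Hk V]].
    destruct (path_bit D X k HX) as [s [B1 [B2 B3]]]. apply B3 in K; auto.
    apply (V s) in K; auto using str_bound. }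
  apply HDC in HX. destruct (path_bit C X (pair n (0 + (t + 1)) + 1) HX) as [s [B1 [B2 B3]]].
  apply HC in B2. destruct B2 as [_ B2]. destruct (B2 n 0 (t + 1)) as [j [Hj B]].
  - exists t. split; auto. lin.
  - rewrite B1. lin.
  - apply (NX (0 + j)). apply B3; auto. rewrite <- B1. apply bit1_lt, B.
Qed.

(** If no long string of D has a zero column n, then iterating the shift pushes
    an entry 1 arbitrarily far down the column. *)
Lemma late_ones n l : (forall s, slen s = l -> s in_ D -> exists i, bit1 s (pair n i)) ->
  forall j, exists l, forall s, s < exp2 l + exp2 l -> slen s = l -> s in_ D ->
    exists i, i < l /\ j < i + 1 /\ bit1 s (pair n i).
Proof.
  intro H0. apply (sig_ind (fun j l => forall s, s < exp2 l + exp2 l -> slen s = l -> s in_ D ->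
    exists i, i < l /\ j < i + 1 /\ bit1 s (pair n i))); [definable| |].
  - exists l. intros s _ Hs HsD. destruct (H0 s Hs HsD) as [i B]. exists i. split.
    + pose proof (bit1_lt _ _ B) as L. rewrite Hs in L. lin L (pair_snd_le n i).
    + split; auto. lin (le0 i).
  - intros j [k H]. exists (k + k + k). intros s _ Hs HsD.
    assert (E : slen (shift_str s) = k) by (rewrite shift_str_slen, Hs; apply third_triple).
    destruct (H (shift_str s)) as [i [_ [Hi B]]]; auto using D_shift_str, str_bound.
    apply shift_str_bit in B. rewrite next_pos_pair in B. destruct B as [_ B].
    exists (i + 1). split; [|split; [lin Hi|auto]].
    pose proof (bit1_lt _ _ B) as L. rewrite Hs in L. lin L (pair_snd_le n (i + 1)).
Qed.

(** A path of D with arbitrarily late entries 1 would have two of them, whose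
    distance makes n enter by [sparse]. *)
Lemma zero_column_ex n l : (forall t, ~ R n t) ->
  exists s, slen s = l /\ s in_ D /\ forall i, ~ bit1 s (pair n i).
Proof.
  intro HN. apply NNPP. intro H.
  assert (H0 : forall s, slen s = l -> s in_ D -> exists i, bit1 s (pair n i)).
  { intros s Hs HsD. apply NNPP. intro K. apply H. exists s. repeat split; auto. intros i B. eauto. }
  pose proof (late_ones n l H0) as A.
  destruct (sys_nonempty (proj1 HD)) as [X HX].
  assert (B : forall j, exists i, j <= i /\ pair n i in_ X).
  { intro j. destruct (A j) as [k K]. destruct (path_bit D X k HX) as [s [B1 [B2 B3]]].
    destruct (K s) as [i [_ [Hi B]]]; auto using str_bound. exists i. split; [apply lt_succ, Hi|].
    apply B3; auto. rewrite <- B1. apply bit1_lt, B. }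
  destruct (B 0) as [i [_ Hi]]. destruct (B (i + 1)) as [i' [L Hi']].
  apply le_ex in L. destruct L as [d ->].
  apply HDC in HX. destruct (path_bit C X (pair n (i + 1 + d) + 1) HX) as [s [B1 [B2 B3]]].
  apply HC in B2. destruct B2 as [B2 _].
  destruct (B2 n i d) as [t [_ Ht]]; [| |apply (HN t Ht)]; apply B3; auto.
  - assert (Q : i <= i + 1 + d) by lin (le0 d). apply lt_succ, pair_mono, Q.
  - replace (i + d + 1) with (i + 1 + d) by ring. lin.
  - replace (i + d + 1) with (i + 1 + d) by ring. auto.
Qed.

(** The strings of D with zero column n form a subsystem, which is all of D by minimality. *)
Lemma zero_column n X : (forall t, ~ R n t) -> path D X -> ~ pair n 0 in_ X.
Proof.
  intros HN HX.
  assert (K : is_set (fun s => s in_ D /\ forall i, i < slen s -> ~ bit1 s (pair n i))) by definable.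
  destruct K as [E HE].
  assert (HE' : forall s, s in_ E <-> s in_ D /\ forall i, ~ bit1 s (pair n i)).
  { intro s. rewrite HE. split; intros [A B]; split; auto. intros i Hi. apply (B i); auto.
    apply bit1_lt in Hi. lin Hi (pair_snd_le n i). }
  assert (T : tree E).
  { intros s t P Q. apply HE'. apply HE' in Q. destruct Q as [Q1 Q2]. split.
    - apply (sys_tree (proj1 HD) P Q1).
    - intros i B. apply (Q2 i). apply prefix_iff in P. apply P; auto. apply bit1_lt, B. }
  assert (S : is_system E f).
  { constructor; auto.
    - apply (sys_map (proj1 HD)).
    - apply wkl_path; auto. intro l. destruct (zero_column_ex n l HN) as [s [A [B Hs]]].
      exists s. split; auto. apply HE'; auto.
    - intros s t Q H. apply Hf in H. subst. apply HE'. apply HE' in Q. destruct Q as [Q1 Q2].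
      split; [apply D_shift_str, Q1|]. intros i B. apply shift_str_bit in B. rewrite next_pos_pair in B.
      apply (Q2 (i + 1)). tauto. }
  apply (proj2 HD E S) in HX.
  - intro B. destruct (path_bit E X (pair n 0 + 1) HX) as [s [B1 [B2 B3]]].
    apply HE' in B2. apply (proj2 B2 0). apply B3; [lin|exact B].
  - intros Y HY k. destruct (HY k) as [s [A B]]. exists s. split; auto. apply HE in B. tauto.
Qed.

(** Compactness: the strings of D that are too short to show position (n, 0) or
    have a 1 there form a tree without paths. *)
Lemma vanish_ex n : (forall t, ~ R n t) -> exists l, vanish n 0 l.
Proof.
  intro HN. apply NNPP. intro H.
  assert (K : is_set (fun s => s in_ D /\ (bit1 s (pair n 0) \/ slen s < pair n 0 + 1))) by definable.
  destruct K as [E HE].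
  destruct (wkl_path E) as [X HX]; auto.
  - intros s t P Q. apply HE. apply HE in Q. destruct Q as [Q1 Q2]. split.
    + apply (sys_tree (proj1 HD) P Q1).
    + apply prefix_iff in P. destruct P as [P1 P2].
      destruct (lt_or_le (slen s) (pair n 0 + 1)) as [|L]; auto. left. apply P2; [lin L|].
      destruct Q2 as [|Q2]; auto. lin Q2 L P1.
  - intro l. destruct (lt_or_le l (pair n 0 + 1)) as [L|L].
    + destruct (sys_nonempty (proj1 HD)) as [X HX].
      destruct (path_bit D X l HX) as [s [B1 [B2 B3]]]. exists s. split; auto. apply HE.
      rewrite B1. auto.
    + apply NNPP. intro N. apply H. exists l. split; [lin L|]. intros s _ Hs HsD B.
      apply N. exists s. split; auto. apply HE. auto.
  - apply (zero_column n X HN).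
    + intro k. destruct (HX k) as [s [A B]]. exists s. split; auto. apply HE in B. tauto.
    + destruct (path_bit E X (pair n 0 + 1) HX) as [s [B1 [B2 B3]]].
      apply HE in B2. destruct B2 as [_ [B2|B2]].
      * apply B3; [lin|exact B2].
      * rewrite B1 in B2. elim (lt_irrefl _ B2).
Qed.
End Minimal.

Lemma coding : is_set (fun n => exists t, R n t).
Proof.
  destruct code_system as [C [f [HS [HC Hf]]]].
  destruct (HP C f HS) as [D [[_ HDC] HD]].
  apply (set_delta _ R (fun n l => vanish D n 0 l)).
  - exact HRr.
  - unfold vanish. definable.
  - tauto.
  - intro n. split.
    + intro H. apply (vanish_ex C D f); auto. intros t Ht; eauto.
    + intros [l H] [t Ht]. eapply not_vanish; eauto.
Qed.
End Coding.

Lemma scons_env (E : nat -> num -> num) : (forall i : nat, is_fun (E i)) ->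
  forall i : nat, is_fun (fun w => scons (psnd w) (fun i : nat => E i (pfst w)) i).
Proof. intros H [|i]; cbn; [definable|]. specialize (H i). definable. Qed.

(** Number variables are interpreted by functions E i of a single number, so that
    quantifiers are covered by the case of one bound variable. *)
Theorem minimal_ACA : WKL M -> minimal_subsystem_principle M -> ACA M.
Proof.
  intros HW HP.
  assert (Hex : forall P, is_set (fun w => P (pfst w) (psnd w)) -> is_set (fun n => exists x, P n x)).
  { intros P H. apply coding; auto. }
  pose proof (set_all Hex) as Hall.
  intros p V e.
  assert (Ht : forall (t : term) (E : nat -> num -> num), (forall i : nat, is_fun (E i)) ->
    is_fun (fun n => eval (fun i : nat => E i n) t)).
  { induction t; intros E HE; cbn.
    - apply HE.
    - apply fun_const.
    - apply fun_const.
    - apply fun_add; auto.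
    - apply fun_mul; auto. }
  enough (K : forall (E : nat -> num -> num), (forall i : nat, is_fun (E i)) ->
    is_set (fun n => sat V (fun i : nat => E i n) p)).
  { destruct (K (fun (i : nat) n => scons n e i)) as [X HX]; [|exists X; exact HX].
    intros [|i]; cbn; definable. }
  clear e. induction p; intros E HE; cbn.
  - apply set_eq; auto.
  - apply set_lt; auto.
  - apply set_mem; auto.
  - apply set_not; auto.
  - apply set_and; auto.
  - apply set_or; auto.
  - apply set_imp; auto.
  - apply Hall. apply (IHp (fun (i : nat) w => scons (psnd w) (fun i : nat => E i (pfst w)) i)).
    apply scons_env, HE.
  - apply Hex. apply (IHp (fun (i : nat) w => scons (psnd w) (fun i : nat => E i (pfst w)) i)).
    apply scons_env, HE.
Qed.

End Model.

Theorem theorem10 (M : L2structure) (HM : WKL0 M) :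
  ACA M <-> minimal_subsystem_principle M.
Proof.
  destruct HM as [HR HW]. split.
  - intros HA C f HS. apply (ACA_minimal M HR HW HA C f HS).
  - apply (minimal_ACA M HR HW).
Qed.
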